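(* Let $X\subset N_{\mathbb R}$ be a one-dimensional balanced polyhedral space and let $\gamma\in\mathrm{PAPC}(X)$ be positive at infinity. For any bounded piecewise affine function $u$ on $X$ defined on a polyhedral structure $\Pi$ where $\gamma$ is also defined (i.e. $u,\gamma\in\mathrm{PA}(\Pi)$), the envelope $P_\gamma(u)$ is in $\mathrm{PAPC}(X,\gamma)$ and is defined on $\Pi$ (i.e. $P_\gamma(u)\in\mathrm{PA}(\Pi)$). In particular, the regularity property holds in dimension one.
   Context: Polyhedral spaces. $N$ is a lattice (free abelian group of finite rank), $M=\mathrm{Hom}(N,\mathbb Z)$, $N_R=N\otimes R$. A rational polyhedron in $N_{\mathbb R}$ is a subset defined by finitely many conditions $f(n)+b=0$ or $f(n)+b\ge 0$ with $f\in M$, $b\in\mathbb Z$. For a polyhedron $\sigma$: $N_{\sigma,\mathbb R}$ is the linear span of all $x-y$, $x,y\in\sigma$; $N_\sigma=N_{\sigma,\mathbb R}\cap N$; $M_\sigma$ is the dual lattice; $\mathrm{rec}(\sigma)=\{v: x+tv\in\sigma\ \forall x\in\sigma,t\ge0\}$. A rational polyhedral complex $\Pi$ is a finite collection of rational polyhedra (its faces), closed under taking faces, two of which meet in the empty set or in a common face; $|\Pi|$ is its support, $\Pi^{(k)}$ its set of $k$-dimensional faces. A one-dimensional polyhedral space is a set $X=|\Pi|$ where all inclusion-maximal faces of $\Pi$ have dimension $1$; any rational polyhedral complex with support $X$ is called a polyhedral structure on $X$. It is balanced if it carries weights $[X](e)\in\mathbb Q_{>0}$ on the edges of some polyhedral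 structure with $\sum_{e\succ v}[X](e)n_{e/v}=0$ at each vertex $v$, where $n_{e/v}\in N_e$ is the primitive vector pointing from $v$ into $e$. Functions. A continuous $\phi:X\to\mathbb R$ is piecewise affine on $\Pi$ if on each $\sigma\in\Pi$ it is the restriction of an affine function with linear part $\phi_\sigma\in M_\sigma\otimes\mathbb Q$ and rational constant term; $\mathrm{PA}(\Pi)$ is the set of these, $\mathrm{PA}(X)=\bigcup_\Pi\mathrm{PA}(\Pi)$. $\gamma\in\mathrm{PA}(\Pi)$ is positive at infinity if $\gamma_\sigma(v)>0$ for every $\sigma\in\Pi$ and non-zero $v\in\mathrm{rec}(\sigma)$. A polyhedral convex combination in $X$ is a triple $(x,(x_i)_{i\in I},(\alpha_i)_{i\in I})$ with $I$ finite, $x_i\in X\cap N_{\mathbb Q}$, $\alpha_i\in[0,1]$, $\sum\alpha_i=1$, $x=\sum\alpha_ix_i\in X$, such that for some polyhedral structure $\Pi$ there are faces $\tau,\sigma_i\in\Pi$ with $x\in\tau$, $x_i\in\sigma_i$, and $\tau$ a (not necessarily proper) face of every $\sigma_i$. $\mathrm{PC}(X)$ is the set of continuous $\phi:X\to\mathbb R$ with $\phi(x)\le\sum\alpha_i\phi(x_i)$ for all such combinations; $\mathrm{PAPC}(X)=\mathrm{PA}(X)\cap\mathrm{PC}(X)$; $\mathrm{PAPC}(X,\gamma)$ is the subset of $\phi$ with $\phi-\gamma$ bounded; $\mathrm{PC}^{\mathrm{reg}}(X,\gamma)$ is the set of uniform limits on $X$ of sequences in $\mathrm{PAPC}(X,\gamma)$.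 Envelope and regularity. For $u$ continuous on $X$, $P_\gamma(u)(x)=\sup\{\psi(x):\psi\in\mathrm{PC}(X),\ \psi\le\gamma+u,\ \psi\le\gamma+O(1)\}$. $(X,\gamma)$ has the regularity property if $P_\gamma(u)\in\mathrm{PC}^{\mathrm{reg}}(X,\gamma)$ for every bounded $u\in\mathrm{PA}(X)$. *)

(* Defs.v *)
From HB Require Import structures.
From mathcomp Require Import all_boot all_order all_algebra.
From mathcomp Require Import all_classical all_reals all_analysis.

Set Implicit Arguments.
Unset Strict Implicit.
Unset Printing Implicit Defensive.

Import Order.TTheory GRing.Theory Num.Theory.
Import numFieldNormedType.Exports.

Local Open Scope classical_set_scope.
Local Open Scope ring_scope.

(* A basis of the lattice is fixed: N = Z^n, N_Q = Q^n and N_R = R^n are spaces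
   of row vectors, and so are the duals M, M_Q and M_R in the dual basis. *)

Section Polyhedra.
Context {R : realType} {n : nat}.
Local Notation NR := 'rV[R]_n.
Implicit Types (f v w x : NR) (s t e : set NR).

Definition pairing f x : R := \sum_i f 0 i * x 0 i.

Definition of_int (z : 'rV[int]_n) : NR := map_mx intr z.
Definition of_rat (q : 'rV[rat]_n) : NR := map_mx ratr q.

Definition lattice : set NR := range of_int.
Definition rational_point : set NR := range of_rat.

Definition rational_polyhedron s : Prop :=
  exists eqs ineqs : seq ('rV[int]_n * int),
    s = [set x | (forall c, c \in eqs -> pairing (of_int c.1) x + c.2%:~R = 0) /\
                 (forall c, c \in ineqs -> 0 <= pairing (of_int c.1) x + c.2%:~R)].

(* The faces are the nonempty loci where a linear functional is minimal;
   f = 0 gives s itself. *)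
Definition is_face t s : Prop :=
  t !=set0 /\
  exists f, t = [set x | s x /\ forall y, s y -> pairing f x <= pairing f y].

(* N_(s,R), the linear span of the differences of points of s *)
Definition dir_space s : set NR :=
  [set v | exists2 D : seq NR,
     (forall w, w \in D -> exists x y, [/\ s x, s y & w = x - y]) &
     v \in <<D>>%VS].

Definition dir_lattice s : set NR := dir_space s `&` lattice.

Definition has_dim s (k : nat) : Prop :=
  exists2 U : {vspace NR}, dir_space s = [set` U] & \dim U = k.

Definition recession s : set NR :=
  [set v | forall x (r : R), s x -> 0 <= r -> s (x + r *: v)].

Implicit Type Pi : set (set NR).

(* The faces of a complex are nonempty: the recession cone of the empty set
   would be the whole space. *)
Definition polyhedral_complex Pi : Prop :=
  [/\ finite_set Pi,
      forall s, Pi s -> rational_polyhedron s /\ s !=set0,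
      forall s t, Pi s -> is_face t s -> Pi t &
      forall s t, Pi s -> Pi t ->
        s `&` t = set0 \/ (is_face (s `&` t) s /\ is_face (s `&` t) t)].

Definition complex_support Pi : set NR := \bigcup_(s in Pi) s.

Definition faces_of_dim Pi (k : nat) : set (set NR) :=
  [set s | Pi s /\ has_dim s k].

Definition polyhedral_structure (X : set NR) Pi : Prop :=
  polyhedral_complex Pi /\ complex_support Pi = X.

Definition one_dim_polyhedral_space (X : set NR) : Prop :=
  exists2 Pi, polyhedral_structure X Pi &
    forall s, Pi s -> (forall t, Pi t -> s `<=` t -> s = t) -> has_dim s 1.

(* w is the primitive vector n_(e/v): it is not a proper multiple in N_e
   (k = 0 excludes w = 0), and it points from v into e. *)
Definition is_primitive_vector e v w : Prop :=
  [/\ dir_lattice e w,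
      forall (k : nat) z, dir_lattice e z -> w = z *+ k -> k = 1%N &
      exists2 r : R, 0 < r & e (v + r *: w)].

Definition primitive_vector e v : NR := xget 0 (is_primitive_vector e v).

Definition balanced (X : set NR) : Prop :=
  exists Pi (W : set NR -> rat),
    [/\ polyhedral_structure X Pi,
        forall e, faces_of_dim Pi 1 e -> 0 < W e &
        forall v, Pi [set v] ->
          \sum_(e \in [set e | faces_of_dim Pi 1 e /\ is_face [set v] e])
             ratr (W e) *: primitive_vector e v = 0].

End Polyhedra.

(* A function on X is given by a total function on N_R, of which only the
   values on X matter. *)
Section Functions.
Context {R : realType} {n : nat}.
Local Notation NR := 'rV[R]_n.
Implicit Types (X s : set NR) (phi psi gamma u : NR -> R) (Pi : set (set NR)).

(* M_Q -> M_s (x) Q is surjective (N_s is saturated in N), so a linear part in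
   M_s (x) Q is given by an element f of M_Q acting on N_(s,R). *)
Definition affine_on phi s (f : 'rV[rat]_n) (c : rat) : Prop :=
  forall x, s x -> phi x = pairing (of_rat f) x + ratr c.

Definition PA_on Pi phi : Prop :=
  {within complex_support Pi, continuous phi} /\
  forall s, Pi s -> exists f c, affine_on phi s f c.

Definition PA X phi : Prop :=
  exists2 Pi, polyhedral_structure X Pi & PA_on Pi phi.

Definition positive_at_infinity X gamma : Prop :=
  exists Pi, [/\ polyhedral_structure X Pi, PA_on Pi gamma &
    forall s f c v, Pi s -> affine_on gamma s f c ->
      recession s v -> v != 0 -> 0 < pairing (of_rat f) v].

Definition polyhedral_convex_combination X (x : NR) (I : finType)
    (xs : I -> NR) (alpha : I -> R) : Prop :=
  [/\ forall i, X (xs i) /\ rational_point (xs i),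
      forall i, 0 <= alpha i <= 1,
      \sum_i alpha i = 1,
      x = \sum_i alpha i *: xs i /\ X x &
      exists Pi (t : set NR) (s : I -> set NR),
        [/\ polyhedral_structure X Pi, Pi t, t x &
            forall i, [/\ Pi (s i), s i (xs i) & is_face t (s i)]]].

Definition PC X phi : Prop :=
  {within X, continuous phi} /\
  forall x (I : finType) (xs : I -> NR) (alpha : I -> R),
    polyhedral_convex_combination X x xs alpha ->
    phi x <= \sum_i alpha i * phi (xs i).

Definition PAPC X phi : Prop := PA X phi /\ PC X phi.

Definition PAPC_at X gamma phi : Prop :=
  PAPC X phi /\ [bounded phi x - gamma x : R^o | x in X].

Definition PCreg_at X gamma phi : Prop :=
  exists2 F : nat -> NR -> R, (forall k, PAPC_at X gamma (F k)) &
    {uniform X, F @ \oo --> phi}.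

Definition envelope X gamma u (x : NR) : \bar R :=
  ereal_sup [set (psi x)%:E | psi in
    [set psi | [/\ PC X psi,
                   forall y, X y -> psi y <= gamma y + u y &
                   exists C : R, forall y, X y -> psi y <= gamma y + C]]].

(* An extended-real-valued function on X is finite and belongs to a class C. *)
Definition belongs_on X (E : NR -> \bar R) (C : set (NR -> R)) : Prop :=
  exists2 phi, C phi & forall x, X x -> E x = (phi x)%:E.

Definition regularity_property X gamma : Prop :=
  forall u, PA X u -> [bounded u x : R^o | x in X] ->
    belongs_on X (envelope X gamma u) (PCreg_at X gamma).

End Functions.

(* Main.v *)
Require Import Defs.
From mathcomp Require Import all_boot all_order all_algebra.
From mathcomp Require Import all_classical all_reals all_analysis.
From mathcomp Require Import ring lra.

(** Write h = gamma + u, a function that is rational affine on every face of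
    Pi.  The envelope is the supremum of the competitors: the functions psi in
    PC(X) with psi <= h (as u is bounded, the growth condition then holds).

    Upper bound.  The faces of Pi are points, segments, half-lines and lines.
    Let g(v) be the supremum of psi(v) - h(v) over the competitors, for each
    vertex v.  Every competitor is convex on each face.  So on a segment
    psi - h lies below the chord of its values at the two endpoints, and on a
    half-line, where psi - h is convex and bounded above, it lies below its
    value at the endpoint.  Hence psi <= phi + h, where phi is affine on
    segments and constant on half-lines with the values g at the vertices, and
    phi = 0 on the faces without vertices (competitor_below).

    The bound is a competitor.  It is affine on faces, so everything happens
    at the vertices.  A relation sum c_k (y_k - w) = 0 with c >= 0 between
    directions of edges at w is a polyhedral convex combination; it constrains
    all competitors, hence their supremum, and the Farkas lemma turns these
    constraints into one linear functional l_w that supports phi + h at w along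
    all edges (vertex_gap_supported).  Conversely, a continuous function with a
    local supporting functional at each point is in PC(X), because it is convex
    along the segments that lie in X (supported_PC).  So phi + h is the
    greatest competitor.

    Rationality.  The previous two steps say that the values of g at the
    vertices, together with the functionals l_w, solve a finite system of
    linear inequalities with rational coefficients, and that every solution of
    this system has vertex values at most g (feasible_competitor).  Were some
    g(v) irrational, the solution could be moved in both directions along a
    rational vector with non-zero coordinate at v (solution_perturb), and one of
    the two would exceed g(v).

    Regularity property.  gamma and u may live on different polyhedral
    structures, but two structures on a one-dimensional space have a common
    refinement (common_refinement), and a function of PAPC(X, gamma) is the
    uniform limit of a constant sequence. *)

Set Implicit Arguments.
Unset Strict Implicit.
Unset Printing Implicit Defensive.

Import Order.TTheory GRing.Theory Num.Theory.
Import numFieldNormedType.Exports.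

Local Open Scope classical_set_scope.
Local Open Scope ring_scope.

(** * The pairing *)

Section Pairing.
Context {R : realType} {n : nat}.
Implicit Types (f x y : 'rV[R]_n) (a : R).

Lemma pairingC f x : pairing f x = pairing x f.
Proof. by apply: eq_bigr => i _; rewrite mulrC. Qed.

Lemma pairingDr f x y : pairing f (x + y) = pairing f x + pairing f y.
Proof. by rewrite -big_split /=; apply: eq_bigr => i _; rewrite mxE mulrDr. Qed.

Lemma pairingZr f a x : pairing f (a *: x) = a * pairing f x.
Proof. by rewrite /pairing mulr_sumr; apply: eq_bigr => i _; rewrite mxE mulrCA. Qed.

Lemma pairingNr f x : pairing f (- x) = - pairing f x.
Proof. by rewrite -scaleN1r pairingZr mulN1r. Qed.

Lemma pairingBr f x y : pairing f (x - y) = pairing f x - pairing f y.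
Proof. by rewrite pairingDr pairingNr. Qed.

Lemma pairing0r f : pairing f 0 = 0.
Proof. by rewrite -(scale0r 0) pairingZr mul0r. Qed.

Lemma pairingDl f x y : pairing (x + y) f = pairing x f + pairing y f.
Proof. by rewrite !(pairingC _ f) pairingDr. Qed.

Lemma pairingNl f x : pairing (- x) f = - pairing x f.
Proof. by rewrite !(pairingC _ f) pairingNr. Qed.

Lemma pairingZl f a x : pairing (a *: x) f = a * pairing x f.
Proof. by rewrite !(pairingC _ f) pairingZr. Qed.

Lemma pairing_sumr f (I : finType) (al : I -> R) (xs : I -> 'rV[R]_n) :
  pairing f (\sum_i al i *: xs i) = \sum_i al i * pairing f (xs i).
Proof.
apply: (big_ind2 (fun u v => pairing f u = v)) => [|? ? ? ? <- <-|i _].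
- exact: pairing0r.
- exact: pairingDr.
- exact: pairingZr.
Qed.

Lemma pairing_self_gt0 x : x != 0 -> 0 < pairing x x.
Proof.
move=> /rV0Pn[i xi]; rewrite /pairing (bigD1 i) //=.
rewrite ltr_pwDl //; first by rewrite -expr2 exprn_even_gt0.
by apply: sumr_ge0 => j _; rewrite -expr2 sqr_ge0.
Qed.

Lemma pairing_continuous f : continuous (pairing f).
Proof.
suff : continuous (fun x : 'rV[R]_n => \sum_i f 0 i * x 0 i) by [].
apply: (@continuous_big R _ +%R 0 _ (@add_continuous R^o)) => i _ x.
exact: (cvgM (cvg_cst (f 0 i)) (@coord_continuous R 1 n 0 i x)).
Qed.

Lemma affine_continuous f a : continuous (fun x => pairing f x + a).
Proof. by move=> x; exact: (cvgD (@pairing_continuous f x) (cvg_cst a)). Qed.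

Lemma pairing_of_rat (f x : 'rV[rat]_n) :
  pairing (of_rat f : 'rV[R]_n) (of_rat x) = ratr (\sum_i f 0 i * x 0 i).
Proof.
by rewrite rmorph_sum /=; apply: eq_bigr => i _; rewrite !mxE rmorphM.
Qed.

End Pairing.

(** * Rational systems of inequalities *)

Lemma uniform_threshold (R : realType) (J : finType) (Q : J -> R -> Prop) :
  (forall j, exists e : R, 0 < e /\ forall t, `|t| <= e -> Q j t) ->
  exists2 e : R, 0 < e & forall t, `|t| <= e -> forall j, Q j t.
Proof.
move=> /choice[e eP]; exists (\big[Num.min/1]_j e j).
  by apply: lt_bigmin => // j _; case: (eP j).
move=> t te j; have [_] := eP j; apply.
by apply: (le_trans te); exact: bigmin_le.
Qed.

Definition is_rational {R : realType} (r : R) := exists q : rat, r = ratr q.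

(** A subspace of maximal rank among those contained in P must be all of P.
    Presenting P by a matrix makes its cokernel, hence linear forms that vanish
    exactly on P, available. *)
Lemma subspace_matrix (N : nat) (P : 'rV[rat]_N -> Prop) :
  P 0 -> (forall v w, P v -> P w -> P (v + w)) ->
  (forall a v, P v -> P (a *: v)) ->
  exists W : 'M[rat]_N, forall v, P v <-> (v <= W)%MS.
Proof.
move=> P0 PD PZ.
pose inP (W : 'M[rat]_N) := forall v : 'rV_N, (v <= W)%MS -> P v.
pose Q r := `[< exists2 W, \rank W = r & inP W >].
have exQ : exists r, Q r.
  by exists 0; apply/asboolP; exists 0; [exact: mxrank0|move=> v /submx0null ->].
have ubQ r : Q r -> (r <= N)%N.
  by move=> /asboolP[W <- _]; exact: rank_leq_row.
case: (ex_maxnP exQ ubQ) => r /asboolP[W rW WP] rmax.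
exists W => v; split=> [Pv|]; last exact: WP.
have /asboolP/rmax : exists2 W' : 'M[rat]_N, \rank W' = \rank (W + v)%MS & inP W'.
  exists (W + v)%MS => // w /sub_addsmxP[[A B] ->] /=.
  apply: PD; first by apply: WP; exact: submxMl.
  by rewrite [B]mx11_scalar mul_scalar_mx; exact: PZ.
rewrite -rW => le_rk.
have /mxrank_leqif_sup/leqifP : (W <= W + v)%MS by exact: addsmxSl.
case: ifP => [sub _|_]; last by rewrite ltnNge le_rk.
by apply: submx_trans sub; exact: addsmxSr.
Qed.

Section RationalSystems.
Context {R : realType} {I J : finType}.
Implicit Types (z : I -> R) (p q : I -> rat).

(** The vectors a such that sum a_i z_i is rational form a subspace over the
    rational numbers, and it misses the basis vector of i0.  The direction p is
    a linear form that vanishes on this subspace but not on that vector. *)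
Lemma irrational_direction z i0 : ~ is_rational (z i0) ->
  exists2 p, p i0 != 0 &
    forall (a : I -> rat), is_rational (\sum_i ratr (a i) * z i) ->
      \sum_i a i * p i = 0.
Proof.
move=> irr.
pose P (v : 'rV[rat]_#|I|) :=
  is_rational (\sum_i ratr (v 0 (enum_rank i)) * z i).
have [W WP] : exists W : 'M[rat]_#|I|, forall v, P v <-> (v <= W)%MS.
  apply: subspace_matrix.
  - by exists 0; rewrite big1 ?rmorph0// => i _; rewrite mxE rmorph0 mul0r.
  - move=> v w [c vc] [d wd]; exists (c + d); rewrite [RHS]rmorphD /= -vc -wd -big_split /=.
    by apply: eq_bigr => i _; rewrite mxE rmorphD mulrDl.
  - move=> a v [c vc]; exists (a * c); rewrite [RHS]rmorphM /= -vc mulr_sumr.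
    by apply: eq_bigr => i _; rewrite mxE rmorphM -mulrA.
have : ~~ ((delta_mx 0 (enum_rank i0) : 'rV_#|I|) <= W)%MS.
  apply/negP => /WP[c ec]; apply: irr; exists c; rewrite -ec (bigD1 i0) //= big1.
    by rewrite mxE !eqxx rmorph1 mul1r addr0.
  by move=> i ii0; rewrite mxE (inj_eq enum_rank_inj) (negPf ii0) andbF rmorph0 mul0r.
rewrite submxE => /rV0Pn[j]; rewrite -rowE mxE => pj.
exists (fun i => cokermx W (enum_rank i) j) => // a [c ac].
have : ((\row_k a (enum_val k)) <= W)%MS.
  apply/WP; exists c; rewrite -ac; apply: eq_bigr => i _.
  by rewrite mxE enum_rankK.
rewrite submxE => /eqP/matrixP/(_ 0 j); rewrite !mxE => ap0; rewrite -[RHS]ap0.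
rewrite [RHS](reindex (@enum_rank I)) /=; last by exact/onW_bij/enum_rank_bij.
by apply: eq_bigr => i _; rewrite mxE enum_rankK.
Qed.

Definition solution (a : J -> I -> rat) (c : J -> rat) z :=
  forall j, 0 <= \sum_i ratr (a j i) * z i + ratr (c j).

Variables (a : J -> I -> rat) (c : J -> rat).

(** An inequality that is tight at z is a rational relation between the
    coordinates of z, so it stays tight along p; the inequalities that are not
    tight leave some room. *)
Lemma solution_perturb z i0 : solution a c z -> ~ is_rational (z i0) ->
  exists p, [/\ p i0 != 0, forall i, is_rational (z i) -> p i = 0 &
    exists2 e : R, 0 < e & forall t : R, `|t| <= e ->
      solution a c (fun i => z i + t * ratr (p i))].
Proof.
move=> sz /irrational_direction[p p0 pP]; exists p; split=> //.
  move=> i [q zi]; have := pP (fun k => (k == i)%:R).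
  have sum1 (F : ringType) (h : I -> F) : \sum_k (k == i)%:R * h k = h i.
    by rewrite (bigD1 i) //= eqxx mul1r big1 ?addr0// => k /negPf ->; rewrite mul0r.
  rewrite sum1; apply; exists q; rewrite -zi -[RHS]sum1.
  by apply: eq_bigr => k _; rewrite ratr_nat.
apply: uniform_threshold => j.
set A := \sum_i ratr (a j i) * z i + ratr (c j).
pose B : R := ratr (\sum_i a j i * p i).
have AB t : \sum_i ratr (a j i) * (z i + t * ratr (p i)) + ratr (c j) = A + t * B.
  rewrite /A /B rmorph_sum mulr_sumr /= addrAC -big_split /=; congr (_ + _).
  by apply: eq_bigr => i _; rewrite rmorphM mulrDr mulrCA.
have [A0|A0] := eqVneq A 0.
  exists 1; split=> // t _; rewrite AB A0 add0r /B pP ?rmorph0 ?mulr0//.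
  by exists (- c j); rewrite rmorphN; apply/eqP; rewrite -addr_eq0 -/A A0.
have Agt0 : 0 < A by rewrite lt_def A0 sz.
have B1 : 0 < `|B| + 1 by rewrite ltr_wpDl.
exists (A / (`|B| + 1)); split; first by rewrite divr_gt0.
move=> t; rewrite ler_pdivlMr // => tB; rewrite AB.
have : - (t * B) <= `|t| * `|B| by rewrite -normrM -normrN ler_norm.
have := normr_ge0 t; nra.
Qed.

(** A short move along a direction of perturbation makes one more coordinate
    rational and does not touch those that are rational already. *)
Lemma rational_solutions_dense z (d : R) : solution a c z -> 0 < d ->
  exists2 q, solution a c (ratr \o q) & forall i, `|ratr (q i) - z i| <= d.
Proof.
have [k] := ubnP #|[set i | ~~ `[< is_rational (z i) >]]%SET|.
elim: k z d => // k IH z d zk sz d0.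
have [[i0 irr]|allrat] := pselect (exists i, ~ is_rational (z i)); last first.
  have /choice[q zq] : forall i, is_rational (z i).
    by move=> i; apply: contra_notP allrat => ?; exists i.
  exists q => [j|i]; last by rewrite -zq subrr normr0 ltW.
  by have := sz j; under eq_bigr do rewrite zq.
have [p [p0 pz [e e0 eP]]] := solution_perturb sz irr.
have /uniform_threshold[e' e'0 e'P] : forall i, exists e : R,
    0 < e /\ forall t, `|t| <= e -> `|t * ratr (p i)| <= d / 2.
  move=> i; have p1 : 0 < `|ratr (p i) : R| + 1 by rewrite ltr_wpDl.
  exists (d / 2 / (`|ratr (p i)| + 1)); split; first by rewrite !divr_gt0.
  move=> t; rewrite ler_pdivlMr // => tp; apply: le_trans tp.
  by rewrite [leLHS]normrM ler_wpM2l // lerDl.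
have rp0 : ratr (p i0) != 0 :> R by rewrite fmorph_eq0.
pose m := Num.min e e' * `|ratr (p i0)|.
have m0 : 0 < m by rewrite mulr_gt0 ?normr_gt0// lt_min e0.
(* t is chosen so that the coordinate i0 of z + t p is the rational number r *)
have [r] : exists r, ratr r \in `](z i0 - m), (z i0 + m)[.
  by apply: rat_in_itvoo; lra.
rewrite in_itv /= -ltr_distlC => rm.
pose t := (ratr r - z i0) / ratr (p i0).
have tm : `|t| <= Num.min e e'.
  by rewrite normrM normfV ler_pdivrMr ?normr_gt0// distrC ltW.
have /andP[te te'] : (`|t| <= e) && (`|t| <= e') by rewrite -le_min.
have [|||q sq qz] := IH (fun i => z i + t * ratr (p i)) (d / 2).
- rewrite ltnS in zk; apply: leq_trans zk; apply: proper_card; apply/properP; split.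
    apply/fintype.subsetP => i; rewrite !inE; apply: contra => /asboolP zi; apply/asboolP.
    by rewrite pz // rmorph0 mulr0 addr0.
  exists i0; rewrite !inE ?negbK; apply/asboolP => //.
  by exists r; rewrite /t mulfVK // addrC subrK.
- exact: eP.
- by rewrite divr_gt0.
exists q => // i; move: (qz i) (e'P _ te' i); rewrite !ler_norml.
move=> /andP[? ?] /andP[? ?]; apply/andP; split; lra.
Qed.

End RationalSystems.

(** * Linear inequalities over the reals *)

Lemma finite_lists_separate (R : realType) (lo hi : seq R) :
  (forall x y, x \in lo -> y \in hi -> x <= y) ->
  exists s, (forall x, x \in lo -> x <= s) /\ (forall y, y \in hi -> s <= y).
Proof.
elim: hi => [_|y hi IH lohi].
  exists (\big[Num.max/0]_(x <- lo) x); split => // x xlo.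
  exact: le_bigmax_seq.
have [|s [slo shi]] := IH.
  by move=> x z xlo zhi; apply: lohi => //; rewrite inE zhi orbT.
exists (Num.min s y); split=> [x xlo|z].
  by rewrite le_min slo // lohi ?mem_head.
by rewrite inE ge_min => /orP[/eqP ->|/shi ->]; rewrite ?lexx ?orbT.
Qed.

(** Fourier-Motzkin elimination of the m-th unknown.  Q is meant to be the cone
    of consequences of the inequalities pairing l D <= q; keeping it abstract
    avoids tracking coefficients when inequalities are combined. *)
Lemma farkas_elimination (R : realType) (n : nat) (Q : 'rV[R]_n -> R -> Prop) :
  (forall D q D' q' (a b : R), Q D q -> Q D' q' -> 0 <= a -> 0 <= b ->
     Q (a *: D + b *: D') (a * q + b * q')) ->
  (forall q, Q 0 q -> 0 <= q) ->
  forall m (L : seq ('rV[R]_n * R)),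
  (forall p : 'rV[R]_n * R, p \in L -> Q p.1 p.2) ->
  (forall p : 'rV[R]_n * R, p \in L -> forall i : 'I_n, (m <= i)%N -> p.1 0 i = 0) ->
  exists l : 'rV[R]_n, forall p : 'rV[R]_n * R, p \in L -> pairing l p.1 <= p.2.
Proof.
move=> QD Q0; elim=> [|m IH] L LQ Lm.
  exists 0 => p pL; rewrite pairingC pairing0r; apply: Q0.
  have <- : p.1 = 0 by apply/rowP => i; rewrite mxE (Lm p pL i).
  exact: LQ.
have [nm|mn] := leqP n m.
  apply: (IH L LQ) => p pL i mi.
  by have := ltn_ord i; rewrite ltnNge (leq_trans nm mi).
pose i := Ordinal mn.
pose pos := [seq p : 'rV[R]_n * R <- L | 0 < p.1 0 i].
pose neg := [seq p : 'rV[R]_n * R <- L | p.1 0 i < 0].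
pose cross (p p' : 'rV[R]_n * R) :=
  ((- p'.1 0 i) *: p.1 + p.1 0 i *: p'.1, (- p'.1 0 i) * p.2 + p.1 0 i * p'.2).
pose L' := [seq p : 'rV[R]_n * R <- L | p.1 0 i == 0] ++ [seq cross p p' | p <- pos, p' <- neg].
have [p|p|l lP] := IH L'.
- rewrite mem_cat mem_filter => /orP[/andP[_ /LQ //]|/allpairsP[[p1 p2] /=]].
  rewrite !mem_filter => -[/andP[p10 /LQ Q1] /andP[p20 /LQ Q2] ->] /=.
  by apply: QD => //; [rewrite oppr_ge0|]; exact: ltW.
- rewrite mem_cat mem_filter => /orP[/andP[/eqP p0 pL]|/allpairsP[[p1 p2] /=]].
    move=> k mk; have [ki|ki] := eqVneq k i; first by rewrite ki.
    by apply: Lm => //; rewrite ltn_neqAle mk andbT eq_sym.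
  rewrite !mem_filter => -[/andP[p10 pL1] /andP[p20 pL2] ->] k mk /=; rewrite !mxE.
  have [->|ki] := eqVneq k i; first by rewrite mulNr mulrC addNr.
  have mk' : (m < k)%N by rewrite ltn_neqAle mk andbT eq_sym.
  by rewrite (Lm _ pL1 _ mk') (Lm _ pL2 _ mk') !mulr0 addr0.
(* each inequality bounds the correction s of l in coordinate i by its slack *)
pose slack (p : 'rV[R]_n * R) := (p.2 - pairing l p.1) / p.1 0 i.
have [|s [slo shi]] := @finite_lists_separate R (map slack neg) (map slack pos).
  move=> _ _ /mapP[p' p'n ->] /mapP[p pp ->].
  have /lP /= : cross p p' \in L'.
    by rewrite mem_cat; apply/orP; right; apply/allpairsP; exists (p, p').
  move: p'n pp; rewrite !mem_filter => /andP[p'0 _] /andP[p0 _].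
  rewrite pairingDr !pairingZr /slack => ll.
  rewrite ler_pdivlMr // mulrAC ler_ndivrMr //; lra.
exists (l + s *: delta_mx 0 i) => p pL.
rewrite pairingDl pairingZl.
have -> : pairing (delta_mx 0 i) p.1 = p.1 0 i.
  rewrite /pairing (bigD1 i) //= big1 ?addr0; first by rewrite mxE !eqxx mul1r.
  by move=> k ki; rewrite mxE (negPf ki) andbF mul0r.
have [p0|p0|p0] := ltgtP (p.1 0 i) 0.
- have /slo : slack p \in map slack neg by rewrite map_f // mem_filter p0.
  by rewrite /slack ler_ndivrMr //; lra.
- have /shi : slack p \in map slack pos by rewrite map_f // mem_filter p0.
  by rewrite /slack ler_pdivlMr //; lra.
- rewrite p0 mulr0 addr0; apply: lP.
  by rewrite mem_cat mem_filter p0 eqxx pL.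
Qed.

Lemma farkas (R : realType) (n : nat) (K : finType) (d : K -> 'rV[R]_n)
    (q : K -> R) :
  (forall c : K -> R, (forall k, 0 <= c k) -> \sum_k c k *: d k = 0 ->
     0 <= \sum_k c k * q k) ->
  exists l, forall k, pairing l (d k) <= q k.
Proof.
move=> dq.
pose Q (D : 'rV[R]_n) (r : R) := exists c : K -> R,
  [/\ forall k, 0 <= c k, D = \sum_k c k *: d k & r = \sum_k c k * q k].
have [||p|p _ i|l lP] := @farkas_elimination R n Q _ _ n [seq (d k, q k) | k <- enum K].
- move=> _ _ _ _ a b [c [c0 -> ->]] [c' [c'0 -> ->]] a0 b0.
  exists (fun k => a * c k + b * c' k); split.
  + by move=> k; rewrite addr_ge0 // mulr_ge0.
  + rewrite !scaler_sumr -big_split /=; apply: eq_bigr => k _.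
    by rewrite !scalerA scalerDl.
  + rewrite !mulr_sumr -big_split /=; apply: eq_bigr => k _.
    by rewrite !mulrA mulrDl.
- by move=> r [c [c0 /esym cd ->]]; exact: dq.
- case/mapP=> k _ ->; exists (fun j => (j == k)%:R); split=> [j| |].
  + exact: ler0n.
  + rewrite (bigD1 k) //= eqxx scale1r big1 ?addr0// => j /negPf ->.
    by rewrite scale0r.
  + rewrite (bigD1 k) //= eqxx mul1r big1 ?addr0// => j /negPf ->.
    by rewrite mul0r.
- by move=> ni; have := ltn_ord i; rewrite ltnNge ni.
exists l => k; apply: (lP (d k, q k)).
by apply: map_f; rewrite mem_enum.
Qed.

(** * Local supporting functionals *)

(** If G exceeded its chord, then so would G minus a small strictly concave
    bump e s (1 - s).  At a maximum of the difference, the supporting line of G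
    contradicts the strict concavity of the bump. *)
Lemma locally_supported_below_chord (R : realType) (G : R -> R) :
  {within `[0, 1], continuous G} ->
  (forall t : R, 0 < t < 1 -> exists b : R, \forall s \near t, G t + b * (s - t) <= G s) ->
  forall t : R, 0 <= t <= 1 -> G t <= (1 - t) * G 0 + t * G 1.
Proof.
move=> cG sG t t01; apply/ler_addgt0Pr => e e0.
pose E s := (1 - s) * G 0 + s * G 1 + e * (s * (1 - s)).
have cE : continuous E.
  move=> s; rewrite /E; apply: cvgD; last first.
    apply: cvgM; first exact: cvg_cst.
    by apply: cvgM => //; apply: cvgB => //; exact: cvg_cst.
  apply: cvgD; apply: cvgM => //; try exact: cvg_cst.
  by apply: cvgB => //; exact: cvg_cst.
have cH : {within `[0, 1], continuous (fun s => G s - E s)}.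
  move=> s; apply: cvgB; first exact: cG.
  by apply: (@continuous_subspaceT R _ `[0, 1] E cE).
have [c c01 cmax] := EVT_max ler01 cH.
have Ht : G t - E t <= G c - E c by apply: cmax; rewrite in_itv.
have Et : E t <= (1 - t) * G 0 + t * G 1 + e by rewrite /E; nra.
have [Hc|Hc] := leP (G c - E c) 0; first lra.
move: c01; rewrite in_itv /= => /andP[c0 c1].
have {}c0 : 0 < c.
  by rewrite lt_def c0 andbT; apply: contraTneq Hc => ->; rewrite /E -leNgt; nra.
have {}c1 : c < 1.
  by rewrite lt_def c1 andbT; apply: contraTneq Hc => <-; rewrite /E -leNgt; nra.
have [|b] := sG c; first by rewrite c0.
move=> /nbhs_ballP[d /= d0 dP].
pose h := Num.min (d / 2) (Num.min c (1 - c)).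
have h0 : 0 < h by rewrite !lt_min divr_gt0 //= c0 subr_gt0.
have [hd [hc hc']] : h <= d / 2 /\ h <= c /\ h <= 1 - c.
  by rewrite !ge_min !lexx !orbT.
have p1 : G c + b * (c + h - c) <= G (c + h).
  by apply: dP; rewrite /ball /= opprD addrA subrr add0r normrN gtr0_norm //; lra.
have p2 : G c + b * (c - h - c) <= G (c - h).
  by apply: dP; rewrite /ball /= opprB addrC subrK gtr0_norm //; lra.
have q1 : G (c + h) - E (c + h) <= G c - E c.
  by apply: cmax; rewrite in_itv /=; apply/andP; split; lra.
have q2 : G (c - h) - E (c - h) <= G c - E c.
  by apply: cmax; rewrite in_itv /=; apply/andP; split; lra.
have EE : E (c + h) + E (c - h) = 2 * E c - 2 * e * h ^+ 2 by rewrite /E; ring.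
have : 0 < 2 * e * h ^+ 2 by rewrite !mulr_gt0 // exprn_gt0.
lra.
Qed.

(** Locally, l is a subgradient at x of the restriction of g to X. *)
Definition supported_at {R : realType} {n : nat} (X : set 'rV[R]_n)
    (g : 'rV[R]_n -> R) (x : 'rV[R]_n) :=
  exists l, \forall y \near x, X y -> g x + pairing l (y - x) <= g y.

Section Supported.
Context {R : realType} {n : nat}.
Implicit Types (X s : set 'rV[R]_n) (g : 'rV[R]_n -> R) (x v : 'rV[R]_n).

Lemma line_continuous x v : continuous (fun t : R => x + t *: v).
Proof.
move=> t; apply: cvgD; first exact: cvg_cst.
by apply: cvgZ; [exact: cvg_id|exact: cvg_cst].
Qed.

Lemma supported_segment X g x v :
  {within X, continuous g} -> (forall y, X y -> supported_at X g y) ->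
  (forall t : R, 0 <= t <= 1 -> X (x + t *: v)) ->
  forall t : R, 0 <= t <= 1 -> g (x + t *: v) <= (1 - t) * g x + t * g (x + v).
Proof.
move=> /subspace_continuousP cg sg Xv t t01.
have [t1 t0] : ((0 : R) <= 1 <= (1 : R)) /\ ((0 : R) <= 0 <= (1 : R)).
  by rewrite !lexx ler01.
pose G (s : R) := g (x + s *: v).
have := @locally_supported_below_chord R G; rewrite /G scale0r addr0 scale1r; apply => //.
  apply/subspace_continuousP => s /=; rewrite in_itv /= => s01.
  apply: (@cvg_trans _ (g @ within X (nbhs (x + s *: v)))); last exact/cg/Xv.
  move=> U gU.
  suff : \forall r \near s, `[0, 1]%classic r -> U (g (x + r *: v)) by [].
  have : \forall r \near s, X (x + r *: v) -> U (g (x + r *: v)).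
    exact: (@line_continuous x v s _ gU).
  apply: filterS => r XU /=.
  by rewrite in_itv /= => r01; apply: XU; exact: Xv.
move=> s /andP[s0 s1].
have [|l lP] := sg (x + s *: v); first by apply: Xv; rewrite !ltW.
exists (pairing l v).
have : \forall r \near s, X (x + r *: v) ->
    g (x + s *: v) + pairing l ((x + r *: v) - (x + s *: v)) <= g (x + r *: v).
  exact: (@line_continuous x v s _ lP).
have : \forall r \near s, r \in `]0, 1[.
  by apply: near_in_itvoo; rewrite in_itv /= s0.
apply: filterS2.
move=> r; rewrite in_itv /= => /andP[r0 r1].
rewrite opprD addrACA subrr add0r -scalerBl pairingZr mulrC; apply.
by apply: Xv; rewrite !ltW.
Qed.

End Supported.

(** * Finite families of sets *)

Lemma ex_maximal_set (T : Type) (L : seq (set T)) (s : set T) :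
  exists t, [/\ t = s \/ t \in L, s `<=` t &
    forall t', t' \in L -> t `<=` t' -> t = t'].
Proof.
elim: L => [|r L [t [tL st tmax]]]; first by exists s; split=> //; left.
have [tr|ntr] := pselect (t `<=` r); last first.
  exists t; split=> //; first by case: tL => [->|tL]; [left|right; rewrite inE tL orbT].
  by move=> t'; rewrite inE => /orP[/eqP ->|]; [|exact: tmax].
exists r; split; [by right; rewrite mem_head|exact: subset_trans tr|].
move=> t'; rewrite inE => /orP[/eqP -> //|t'L rt'].
have tt' : t = t' by apply: tmax => //; exact: subset_trans rt'.
by apply/seteqP; split=> //; rewrite -tt'.
Qed.

(** One of the finitely many sets contains infinitely many terms of q. *)
Lemma pigeonhole3 (T : Type) (L : seq (set T)) (q : nat -> T) :
  (forall k, exists2 s, s \in L & s (q k)) ->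
  exists s k1 k2 k3, [/\ s \in L, (k1 < k2)%N, (k2 < k3)%N & [/\ s (q k1), s (q k2) & s (q k3)]].
Proof.
move=> cov.
have [[s sL sinf]|nex] := pselect (exists2 s, s \in L & infinite_set [set k | s (q k)]).
  have next N : exists2 k, (N < k)%N & s (q k).
    apply: contra_notP sinf => nex; apply: (@sub_finite_set _ _ `I_N.+1) => //.
    by move=> k /= sk; rewrite ltnNge; apply/negP => Nk; apply: nex; exists k.
  have [k1 _ sk1] := next 0; have [k2 k12 sk2] := next k1.
  by have [k3 k23 sk3] := next k2; exists s, k1, k2, k3.
exfalso; apply: infinite_nat.
have -> : [set: nat] = \bigcup_(s in [set` L]) [set k | s (q k)].
  by apply/seteqP; split=> k // _; have [s sL sk] := cov k; exists s.
apply: bigcup_finite => [|s sL]; first exact: finite_seq.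
by apply: contra_notP nex => sinf; exists s.
Qed.

(** * Rational polyhedra *)

Section Polyhedra.
Context {R : realType} {n : nat}.
Implicit Types (s t : set 'rV[R]_n) (x y w d : 'rV[R]_n).

Lemma rational_polyhedron_system s : rational_polyhedron s ->
  exists (J : finType) (a : J -> 'I_n -> rat) (c : J -> rat),
    forall x, s x <-> solution a c (x 0).
Proof.
move=> [eqs [ineqs ->]].
pose opp (p : 'rV[int]_n * int) := (- p.1, - p.2).
pose L := ineqs ++ eqs ++ map opp eqs.
pose a (j : 'I_(size L)) i := ((nth 0 L j).1 0 i)%:~R : rat.
pose c (j : 'I_(size L)) := (nth 0 L j).2%:~R : rat.
exists 'I_(size L), a, c => x.
have solE : solution a c (x 0) <->
    forall p, p \in L -> 0 <= pairing (of_int p.1) x + p.2%:~R.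
  have aE j : \sum_i ratr (a j i) * x 0 i + ratr (c j) =
      pairing (of_int (nth 0 L j).1) x + (nth 0 L j).2%:~R.
    rewrite ratr_int; congr (_ + _); apply: eq_bigr => i _.
    by rewrite ratr_int !mxE.
  split=> [sol p /(nthP 0)[j jL <-]|sol j].
    by have := sol (Ordinal jL); rewrite aE.
  by rewrite aE; apply: sol; apply: mem_nth.
have oppE p : pairing (of_int (opp p).1) x + (opp p).2%:~R =
    - (pairing (of_int p.1) x + p.2%:~R).
  have -> : of_int (opp p).1 = - of_int p.1 :> 'rV[R]_n.
    by apply/rowP => i; rewrite !mxE rmorphN.
  by rewrite pairingNl rmorphN opprD.
rewrite solE; split=> [[/= xe xi] p|sol].
  rewrite !mem_cat => /or3P[/xi //|/xe -> //|/mapP[p' /xe p'0 ->]].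
  by rewrite oppE p'0 oppr0.
split=> p pL; last by apply: sol; rewrite mem_cat pL.
apply/eqP; rewrite eq_le sol ?mem_cat ?pL ?orbT // andbT -oppr_ge0 -oppE.
by apply: sol; rewrite !mem_cat map_f ?orbT.
Qed.

Lemma polyhedron_convex s x y (t : R) : rational_polyhedron s ->
  s x -> s y -> 0 <= t <= 1 -> s (x + t *: (y - x)).
Proof.
move=> /rational_polyhedron_system[J [a [c sP]]] /sP sx /sP sy /andP[t0 t1].
apply/sP => j; have := sx j; have := sy j.
set A := \sum_i ratr (a j i) * x 0 i; set B := \sum_i ratr (a j i) * y 0 i.
have -> : \sum_i ratr (a j i) * (x + t *: (y - x)) 0 i = A + t * (B - A).
  rewrite /A /B -sumrB mulr_sumr -big_split /=; apply: eq_bigr => i _.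
  by rewrite !mxE; ring.
move=> *; nra.
Qed.

Lemma polyhedron_closed s : rational_polyhedron s -> closed s.
Proof.
move=> /rational_polyhedron_system[J [a [c sP]]].
have -> : s = \bigcap_(j in setT)
    [set x | 0 <= pairing (\row_i ratr (a j i)) x + ratr (c j)].
  have E x j : pairing (\row_i ratr (a j i)) x = \sum_i ratr (a j i) * x 0 i.
    by apply: eq_bigr => i _; rewrite mxE.
  apply/seteqP; split=> x; first by move=> /sP sx j _ /=; rewrite E.
  by move=> sx; apply/sP => j; rewrite -E; exact: sx.
apply: closed_bigI => j _.
apply: (@preimage_closed _ _ (fun x => pairing (\row_i ratr (a j i)) x + ratr (c j))
  [set r | 0 <= r]); last exact: closed_ge.
by move=> x _; exact: affine_continuous.
Qed.

Lemma polyhedron_rational_near s x (e : R) : rational_polyhedron s -> s x -> 0 < e ->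
  exists y, [/\ s y, rational_point y & forall i, `|y 0 i - x 0 i| <= e].
Proof.
move=> /rational_polyhedron_system[J [a [c sP]]] /sP sx e0.
have [q sq qx] := rational_solutions_dense sx e0.
exists (of_rat (\row_i q i)); split.
- apply/sP; suff -> : (of_rat (\row_i q i) : 'rV[R]_n) 0 = ratr \o q by [].
  by apply/funext => i; rewrite !mxE.
- by exists (\row_i q i).
- by move=> i; rewrite !mxE.
Qed.

Lemma rational_vertex x : rational_polyhedron [set x] -> rational_point x.
Proof.
by move=> px; have [y [-> //]] := polyhedron_rational_near px erefl ltr01.
Qed.

Lemma polyhedron_rational_other s x w : rational_polyhedron s -> s x -> x != w ->
  exists y, [/\ s y, rational_point y & y != w].
Proof.
move=> ps sx; rewrite -subr_eq0 => /rV0Pn[i]; rewrite !mxE -normr_gt0 => xw.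
have [y [sy ry yx]] := polyhedron_rational_near ps sx (divr_gt0 xw (ltr0n _ 2)).
exists y; split=> //; apply: contraTneq (yx i) => ->.
rewrite -ltNge (distrC (w 0 i)); lra.
Qed.

Lemma polyhedronI s t : rational_polyhedron s -> rational_polyhedron t ->
  rational_polyhedron (s `&` t).
Proof.
move=> [e [i ->]] [e' [i' ->]]; exists (e ++ e'), (i ++ i').
apply/seteqP; split=> x /=.
  move=> [[xe xi] [xe' xi']]; split=> c.
    by rewrite mem_cat => /orP[/xe|/xe'].
  by rewrite mem_cat => /orP[/xi|/xi'].
move=> [xe xi]; split; split=> c cL.
- by apply: xe; rewrite mem_cat cL.
- by apply: xi; rewrite mem_cat cL.
- by apply: xe; rewrite mem_cat cL orbT.
- by apply: xi; rewrite mem_cat cL orbT.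
Qed.

(** * One-dimensional complexes *)

(** Dimension at most one, stated by points: this form passes to subsets and
    can be read off from finitely many points of a polyhedron. *)
Definition collinear s := forall a b c, s a -> s b -> s c -> a != b ->
  exists k : R, c = a + k *: (b - a).

Lemma is_face_sub t s : is_face t s -> t `<=` s.
Proof. by move=> [_ [f ->]] x []. Qed.

(** A functional that agrees at two points is constant on the line through
    them. *)
Lemma face_two_points s t p q : collinear s -> is_face t s ->
  t p -> t q -> p != q -> t = s.
Proof.
move=> cs [_ [f ->]] [sp fp] [sq fq] pq; apply/seteqP; split=> [x []//|x sx].
split=> // y sy; have [k ->] := cs p q x sp sq sx pq.
rewrite pairingDr pairingZr pairingBr.
have -> : pairing f q = pairing f p by apply/eqP; rewrite eq_le fp // fq.
by rewrite subrr mulr0 addr0; exact: fp.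
Qed.

Lemma faces_meet (Pi : set (set 'rV[R]_n)) s t x : polyhedral_complex Pi ->
  (forall r, Pi r -> collinear r) -> Pi s -> Pi t -> s x -> t x ->
  s = t \/ Pi [set x].
Proof.
move=> [_ _ Pf Pm] cPi Ps Pt sx tx.
have [st0|[fs ft]] := Pm s t Ps Pt.
  by have : (s `&` t) x by []; rewrite st0.
have [[y sty yx]|nex] := pselect (exists2 y, (s `&` t) y & y != x).
  have stx : (s `&` t) x by [].
  left; rewrite -(face_two_points (cPi s Ps) fs sty stx yx).
  exact: (face_two_points (cPi t Pt) ft sty stx yx).
right; have <- : s `&` t = [set x]; last exact: Pf fs.
apply/seteqP; split=> y; last by move=> ->.
by move=> sty; apply: contra_notP nex => /eqP; exists y.
Qed.

Lemma one_dim_cover (X : set 'rV[R]_n) : one_dim_polyhedral_space X ->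
  exists2 L : seq (set 'rV[R]_n), X `<=` \bigcup_(s in [set` L]) s &
    forall s, s \in L -> exists d, forall x y, s x -> s y -> exists k : R, x - y = k *: d.
Proof.
move=> [Pi [[/finite_seqP[L PiL] _ _ _] <-] maxdim].
have Pimem s : Pi s = (s \in L) by rewrite PiL.
exists L; first by rewrite /complex_support PiL.
move=> s sL; have [t [tL st tmax]] := ex_maximal_set L s.
have {}tL : t \in L by case: tL => [->|].
have [] := maxdim t; first by rewrite Pimem.
  by move=> t'; rewrite Pimem; exact: tmax.
move=> U tU dimU; exists (vpick U) => x y sx sy.
have U0 : vpick U != 0 by rewrite vpick0 -dimv_eq0 dimU.
have UE : <[vpick U]>%VS = U.
  by apply/eqP; rewrite eqEdim dimU dim_vline U0 -memvE memv_pick.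
apply/vlineP; rewrite UE.
have : dir_space t (x - y).
  exists [:: x - y] => [w|]; last by rewrite span_seq1 memv_line.
  by rewrite inE => /eqP ->; exists x, y; split=> //; exact: st.
by rewrite tU.
Qed.

(** A face of any polyhedral structure is covered by finitely many subsets of
    lines, the faces of a one-dimensional structure.  Given a, b, c in the face,
    infinitely many points q of a parabola arc through a, with tangent b - a and
    second order term c - a, lie in the face, so three of them lie on a line,
    which is possible only when the parabola degenerates. *)
Lemma structure_collinear (X : set 'rV[R]_n) Pi s :
  one_dim_polyhedral_space X -> polyhedral_structure X Pi -> Pi s -> collinear s.
Proof.
move=> /one_dim_cover[L XL Lline] [[_ Ppoly _ _] PiX] Ps a b c sa sb sc ab.
have [ps _] := Ppoly s Ps.
pose t (k : nat) : R := (k.+2%:R)^-1.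
pose q k := a + t k *: (b - a) + t k ^+ 2 *: (c - a).
have t0 k : 0 < t k by rewrite invr_gt0 ltr0n.
have thalf k : t k <= 2^-1 by rewrite lef_pV2 ?posrE ?ltr0n // ler_nat.
have sq k : s (q k).
  have tt : 0 <= t k / (1 + t k) <= 1.
    have := t0 k => tk; rewrite divr_ge0 ?ler_pdivrMr /=; lra.
  have := polyhedron_convex ps sa (polyhedron_convex ps sb sc tt) (t := t k + t k ^+ 2).
  have -> : a + (t k + t k ^+ 2) *: (b + t k / (1 + t k) *: (c - b) - a) = q k.
    apply/rowP => i; rewrite !mxE; field; have := t0 k; lra.
  by apply; have := t0 k; have := thalf k; nra.
have [k|r [k1 [k2 [k3 [rL k12 k23 [r1 r2 r3]]]]]] := @pigeonhole3 _ L q.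
  have /XL[r] : X (q k) by rewrite -PiX; exists s.
  by exists r.
have [d dP] := Lline r rL.
have tlt k k' : (k < k')%N -> t k' < t k.
  by move=> kk'; rewrite ltf_pV2 ?posrE ?ltr0n // ltr_nat.
have [m12 E12] := dP _ _ r1 r2; have [m13 E13] := dP _ _ r1 r3.
have t12 := tlt _ _ k12; have t23 := tlt _ _ k23.
have t12' : t k1 - t k2 != 0 by rewrite subr_eq0 gt_eqF.
have t13' : t k1 - t k3 != 0 by rewrite subr_eq0 gt_eqF // (lt_trans t23).
have t23' : t k2 - t k3 != 0 by rewrite subr_eq0 gt_eqF.
pose kc := (m12 / (t k1 - t k2) - m13 / (t k1 - t k3)) / (t k2 - t k3).
have Ec : c - a = kc *: d.
  apply/rowP => i; move/rowP/(_ i): E12; move/rowP/(_ i): E13; rewrite /kc !mxE.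
  set ai := a 0 i; set bi := b 0 i; set ci := c 0 i; set di := d 0 i => E13 E12.
  have -> : (m12 / (t k1 - t k2) - m13 / (t k1 - t k3)) / (t k2 - t k3) * di =
    (m12 * di / (t k1 - t k2) - m13 * di / (t k1 - t k3)) / (t k2 - t k3).
    by field; rewrite t12' t13' t23'.
  by rewrite -E12 -E13; field; rewrite t12' t13' t23'.
pose kb := m12 / (t k1 - t k2) - (t k1 + t k2) * kc.
have Eb : b - a = kb *: d.
  apply/rowP => i; move/rowP/(_ i): E12; move/rowP/(_ i): Ec; rewrite /kb !mxE.
  set ai := a 0 i; set bi := b 0 i; set ci := c 0 i; set di := d 0 i => Ec' E12.
  have -> : (m12 / (t k1 - t k2) - (t k1 + t k2) * kc) * di =
    m12 * di / (t k1 - t k2) - (t k1 + t k2) * (kc * di) by ring.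
  by rewrite -E12 -Ec'; field; rewrite t12'.
have kb0 : kb != 0.
  by apply: contraNneq ab => kb0; rewrite -subr_eq0 -opprB Eb kb0 scale0r oppr0.
exists (kc / kb); rewrite Eb scalerA divfK // -Ec addrC subrK //.
Qed.

End Polyhedra.

(** * Supporting functionals and polyhedral convexity *)

(** Supporting functionals at all points make g convex along each segment
    [x, x_i].  This extends the support inequality at x from a neighbourhood of
    x to the points x_i, and the weighted sum of the extended inequalities is
    the condition of polyhedral convexity. *)
Lemma supported_PC (R : realType) (n : nat) (X : set 'rV[R]_n) (g : 'rV[R]_n -> R) :
  {within X, continuous g} -> (forall x, X x -> supported_at X g x) -> PC X g.
Proof.
move=> cg sg; split=> // x I xs al.
move=> [Xxs al01 al1 [xE Xx] [Pi [t [s [[[_ Ppoly _ _] PiX] Pt tx sP]]]]].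
have [l lP] := sg x Xx.
have below i : g x + pairing l (xs i - x) <= g (xs i).
  have [Psi sxi ts] := sP i; have [psi _] := Ppoly _ Psi.
  have segX (r : R) : 0 <= r <= 1 -> X (x + r *: (xs i - x)).
    move=> r01; rewrite -PiX; exists (s i) => //.
    by apply: polyhedron_convex => //; exact: is_face_sub tx.
  have : \forall r \near (0 : R), X (x + r *: (xs i - x)) ->
      g x + pairing l (x + r *: (xs i - x) - x) <= g (x + r *: (xs i - x)).
    have := @line_continuous R n x (xs i - x) 0; rewrite /continuous_at scale0r addr0.
    by move=> lim; exact: (lim _ lP).
  move=> /nbhs_ballP[e /= e0 eP].
  (* a parameter at which the local support inequality already holds *)
  pose r := Num.min (e / 2) 1.
  have [r0 [r1 re]] : 0 < r /\ r <= 1 /\ r <= e / 2.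
    by rewrite lt_min divr_gt0 // ltr01 !ge_min !lexx !orbT.
  have r01 : 0 <= r <= 1 by rewrite ltW.
  have br : ball 0 e r by rewrite /ball /= sub0r normrN gtr0_norm //; lra.
  have := supported_segment cg sg segX r01; rewrite (addrC x (xs i - x)) subrK.
  have := eP r br (segX r r01); rewrite [x + r *: _]addrC addrK pairingZr => lo hi.
  by rewrite -(ler_pM2l r0); lra.
rewrite -[leLHS](_ : \sum_i al i * (g x + pairing l (xs i - x)) = g x).
  by apply: ler_sum => i _; rewrite ler_wpM2l //; case/andP: (al01 i).
under eq_bigr do rewrite mulrDr pairingBr mulrBr.
rewrite big_split sumrB /= -!mulr_suml al1 !mul1r -pairing_sumr -xE.
by rewrite subrr addr0.
Qed.

(** * Refining and gluing on complexes *)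

Section Complexes.
Context {R : realType} {n : nat}.
Implicit Types (X s t : set 'rV[R]_n) (x y w : 'rV[R]_n) (Pi : set (set 'rV[R]_n)).

(** The functional that cuts out the endpoint is the pairing with the direction
    b - x of s. *)
Lemma endpoint_face s x b : collinear s -> s x -> s b -> b != x ->
  (forall e : R, 0 < e -> ~ s (x - e *: (b - x))) -> is_face [set x] s.
Proof.
move=> cs sx sb bx xend; split; first by exists x.
have xb0 : 0 < pairing (b - x) (b - x) by rewrite pairing_self_gt0 ?subr_eq0.
have param y : s y -> exists2 k : R, 0 <= k & y = x + k *: (b - x).
  move=> sy; have [|k yE] := cs x b y sx sb sy; first by rewrite eq_sym.
  exists k => //; rewrite leNgt; apply/negP => k0.
  by apply: (xend (- k)); rewrite ?oppr_gt0 // scaleNr opprK -yE.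
exists (b - x); apply/seteqP; split=> [_ -> /=|y [sy ymin]].
  split=> // y /param[k k0 ->].
  by rewrite pairingDr pairingZr lerDl mulr_ge0 // ltW.
have [k k0 yE] := param y sy; have := ymin x sx.
rewrite yE pairingDr pairingZr gerDl pmulr_lle0 // => k0'.
by have -> : k = 0; [apply/eqP; rewrite eq_le k0'|rewrite /= scale0r addr0].
Qed.

(** The refinement consists of the nonempty intersections of faces.  That it
    contains its faces uses dimension one: an endpoint of s1 `&` s2 where
    neither s1 nor s2 ends would not be an endpoint. *)
Lemma common_refinement X Pi1 Pi2 : one_dim_polyhedral_space X ->
  polyhedral_structure X Pi1 -> polyhedral_structure X Pi2 ->
  exists2 Pi, polyhedral_structure X Pi & forall s, Pi s ->
    (exists2 s1, Pi1 s1 & s `<=` s1) /\ (exists2 s2, Pi2 s2 & s `<=` s2).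
Proof.
move=> hX S1 S2; have col1 := structure_collinear hX S1.
have col2 := structure_collinear hX S2.
move: S1 S2 => [[fin1 poly1 face1 meet1] X1] [[fin2 poly2 face2 meet2] X2].
pose Pi := [set s | s !=set0 /\ exists s1 s2, [/\ Pi1 s1, Pi2 s2 & s = s1 `&` s2]].
exists Pi; last first.
  move=> _ [_ [s1 [s2 [P1 P2 ->]]]].
  by split; [exists s1 => // x []|exists s2 => // x []].
split; last first.
  rewrite -[RHS]setIid -{1}X1 -X2; apply/seteqP; split=> x.
    by move=> [_ [_ [s1 [s2 [P1 P2 ->]]]] [sx1 sx2]]; split; [exists s1|exists s2].
  move=> [[s1 P1 sx1] [s2 P2 sx2]]; exists (s1 `&` s2) => //.
  by split; [exists x|exists s1, s2].
split.
- apply: sub_finite_set (finite_image2 setI fin1 fin2).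
  by move=> _ [_ [s1 [s2 [P1 P2 ->]]]]; exists s1 => //; exists s2.
- move=> s [ne [s1 [s2 [P1 P2 sE]]]]; split=> //; rewrite sE.
  by apply: polyhedronI; [case: (poly1 _ P1)|case: (poly2 _ P2)].
- move=> s F [_ [s1 [s2 [P1 P2 ->]]]] faceF.
  have colI : collinear (s1 `&` s2).
    by move=> a b c [a1 _] [b1 _] [c1 _]; exact: (col1 _ P1).
  have [[x Fx] [f FE]] := faceF.
  have [s1x s2x] := is_face_sub faceF Fx.
  have xmin y : (s1 `&` s2) y -> pairing f x <= pairing f y.
    by move: Fx; rewrite FE => -[_]; exact.
  have [[y Fy yx]|nF] := pselect (exists2 y, F y & y != x).
    rewrite (face_two_points colI faceF Fy Fx yx).
    by split; [exists x|exists s1, s2].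
  have {}FE' : F = [set x].
    apply/seteqP; split=> y; last by move=> ->.
    by move=> Fy; apply: contra_notP nF => /eqP; exists y.
  have [[b [s1b s2b] bx]|nI] := pselect (exists2 b, (s1 `&` s2) b & b != x); last first.
    split; first by exists x.
    exists s1, s2; split=> //; rewrite FE'; apply/seteqP; split=> y; first by move=> ->.
    by move=> Iy; apply: contra_notP nI => /eqP; exists y.
  have fxb : pairing f x < pairing f b.
    rewrite lt_neqAle xmin // andbT; apply/eqP => fxb.
    apply: nF; exists b => //; rewrite FE; split=> // y Iy.
    by rewrite -fxb; exact: xmin.
  (* x is an endpoint of s1 `&` s2: it is a vertex as soon as s1 or s2 ends
     there, and otherwise the intersection continues beyond x *)
  have [end1|ne1] := pselect (forall e : R, 0 < e -> ~ s1 (x - e *: (b - x))).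
    have := face1 _ _ P1 (endpoint_face (col1 _ P1) s1x s1b bx end1) => P1x.
    split; first by exists x.
    by exists [set x], s2; split=> //; rewrite FE'; apply/seteqP; split=> [y ->|y []].
  have [end2|ne2] := pselect (forall e : R, 0 < e -> ~ s2 (x - e *: (b - x))).
    have := face2 _ _ P2 (endpoint_face (col2 _ P2) s2x s2b bx end2) => P2x.
    split; first by exists x.
    by exists s1, [set x]; split=> //; rewrite FE'; apply/seteqP; split=> [y ->|y []].
  exfalso.
  have ext s0 : rational_polyhedron s0 -> s0 x ->
      ~ (forall e : R, 0 < e -> ~ s0 (x - e *: (b - x))) ->
      exists2 e : R, 0 < e & forall r, 0 <= r <= e -> s0 (x - r *: (b - x)).
    move=> ps sx /existsNP[e /not_implyP[e0 /contrapT se]]; exists e => // r /andP[r0 re].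
    have -> : x - r *: (b - x) = x + (r / e) *: (x - e *: (b - x) - x).
      rewrite [x - e *: _ - x]addrAC subrr add0r scalerN scalerA divfK ?gt_eqF //.
    apply: polyhedron_convex => //.
    by rewrite divr_ge0 ?(ltW e0) //= ler_pdivrMr // mul1r.
  have [e1 e10 e1P] := ext _ (proj1 (poly1 _ P1)) s1x ne1.
  have [e2 e20 e2P] := ext _ (proj1 (poly2 _ P2)) s2x ne2.
  pose e := Num.min e1 e2.
  have e0 : 0 < e by rewrite lt_min e10.
  have : pairing f x <= pairing f (x - e *: (b - x)).
    by apply: xmin; split; [apply: e1P|apply: e2P]; rewrite (ltW e0) ge_min lexx ?orbT.
  rewrite pairingBr pairingZr pairingBr; nra.
- move=> _ _ [_ [s1 [s2 [P1 P2 ->]]]] [_ [t1 [t2 [Q1 Q2 ->]]]].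
  have [->|/set0P[x [[s1x s2x] [t1x t2x]]]] := eqVneq (s1 `&` s2 `&` (t1 `&` t2)) set0.
    by left.
  right.
  have [I0|[[_ [f1 f1E]] [_ [g1 g1E]]]] := meet1 _ _ P1 Q1.
    by have : (s1 `&` t1) x by []; rewrite I0.
  have [I0|[[_ [f2 f2E]] [_ [g2 g2E]]]] := meet2 _ _ P2 Q2.
    by have : (s2 `&` t2) x by []; rewrite I0.
  have aux (a1 a2 b : set 'rV[R]_n) f f' :
      a1 `&` a2 `&` b = [set y | a1 y /\ forall z, a1 z -> pairing f y <= pairing f z]
        `&` [set y | a2 y /\ forall z, a2 z -> pairing f' y <= pairing f' z] ->
      (a1 `&` a2 `&` b) x -> is_face (a1 `&` a2 `&` b) (a1 `&` a2).
    move=> IE Ix; split; first by exists x.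
    (* where f and f' are minimal at the same point, f + f' is minimal exactly
       at their common minima *)
    exists (f + f'); rewrite IE; apply/seteqP; split=> y /=.
      move=> [[a1y miny] [a2y miny']]; split=> // z [a1z a2z].
      by rewrite !pairingDl lerD ?miny ?miny'.
    move=> [[a1y a2y] miny].
    move: Ix; rewrite IE => -[[a1x minx] [a2x minx']].
    have := miny x (conj a1x a2x); rewrite !pairingDl => le_yx.
    have := minx y a1y; have := minx' y a2y => le' le_.
    split; split=> // z az.
      by apply: le_trans (minx z az); lra.
    by apply: le_trans (minx' z az); lra.
  split.
    apply: (aux _ _ _ f1 f2) => //; rewrite -f1E -f2E.
    by rewrite setIACA.
  rewrite setIC; apply: (aux _ _ _ g1 g2) => //; rewrite -g1E -g2E.
  by rewrite setIACA [t1 `&` _]setIC [t2 `&` _]setIC.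
Qed.

Lemma PA_on_refinement X Pi1 Pi phi : polyhedral_structure X Pi1 ->
  polyhedral_structure X Pi -> (forall s, Pi s -> exists2 s1, Pi1 s1 & s `<=` s1) ->
  PA_on Pi1 phi -> PA_on Pi phi.
Proof.
move=> [_ X1] [_ X2] sub [cphi aphi]; split; first by rewrite X2 -X1.
move=> s /sub[s1 P1 ss1]; have [f [c fc]] := aphi s1 P1.
by exists f, c => x /ss1; exact: fc.
Qed.

(** Near x the support of Pi is the star of x. *)
Lemma complex_locally_finite Pi x : polyhedral_complex Pi ->
  \forall y \near x, forall s, Pi s -> s y -> s x.
Proof.
move=> [/finite_seqP[L PiL] Ppoly _ _].
have {}Ppoly s : s \in L -> closed s.
  by move=> sL; apply: polyhedron_closed; have [] : rational_polyhedron s /\ s !=set0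
    by apply: Ppoly; rewrite PiL.
have : \forall y \near x, forall s, s \in L -> s y -> s x.
  elim: L Ppoly {PiL} => [|s L IH] clL; first by near=> y => s.
  have [sx|nsx] := pselect (s x).
    have := IH (fun s sL => clL s (mem_behead (s := _ :: _) sL)).
    apply: filterS => y yL t; rewrite inE => /orP[/eqP -> //|]; exact: yL.
  have : \forall y \near x, ~ s y.
    by apply: open_nbhs_nbhs; split=> //; apply: closed_openC; apply: clL; exact: mem_head.
  have := IH (fun s sL => clL s (mem_behead (s := _ :: _) sL)).
  apply: filterS2 => y yL nsy t; rewrite inE => /orP[/eqP -> //|]; exact: yL.
by apply: filterS => y yL s; rewrite PiL => /yL.
Unshelve. all: by end_near. Qed.

Lemma affine_faces_continuous Pi (phi : 'rV[R]_n -> R) : polyhedral_complex Pi ->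
  (forall s, Pi s -> exists f c, forall x, s x -> phi x = pairing f x + c) ->
  {within complex_support Pi, continuous phi}.
Proof.
move=> [/finite_seqP[L PiL] Ppoly _ _] aff.
have LP s : s \in L -> closed s /\ {within s, continuous phi}.
  move=> sL; have Ps : Pi s by rewrite PiL.
  split; first by apply: polyhedron_closed; case: (Ppoly s Ps).
  have [f [c fc]] := aff s Ps.
  apply: (@subspace_eq_continuous _ s _ (fun x => pairing f x + c)).
    by move=> x; rewrite inE => sx; exact/esym/fc.
  by apply: continuous_subspaceT; exact: affine_continuous.
have -> : complex_support Pi = \big[setU/set0]_(s <- L) s.
  by rewrite /complex_support PiL bigcup_seq.
elim: L LP {PiL} => [|s L IH] LP.
  by rewrite big_nil; apply/subspace_continuousP.
have LP' t : t \in L -> closed t /\ {within t, continuous phi}.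
  by move=> tL; apply: LP; rewrite inE tL orbT.
rewrite big_cons; apply: withinU_continuous.
- by case: (LP s (mem_head _ _)).
- by apply: closed_bigsetU => t /LP'[].
- by case: (LP s (mem_head _ _)).
- exact: IH.
Qed.

End Complexes.

(** * Edges seen from their vertices *)

Section Spokes.
Context {R : realType} {n : nat}.
Implicit Types (s : set 'rV[R]_n) (x y w o v : 'rV[R]_n) (g phi : 'rV[R]_n -> R).

(** The face s as seen from its vertex w: either the segment from w to y = o,
    or the half-line from w through y, for which o = w.  The point o carries
    the value that an interpolated function approaches along s: the opposite
    vertex of a segment, and w itself on a half-line, where interpolated
    functions are constant.  The face {w} is the case w = o = y. *)
Definition spoke s w o y := (o = y \/ o = w) /\
  forall x, s x <-> exists t : R, [/\ 0 <= t, o = y -> t <= 1 & x = w + t *: (y - w)].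

Lemma spoke_start s w o y : spoke s w o y -> s w.
Proof. by move=> [_ sP]; apply/sP; exists 0; rewrite scale0r addr0. Qed.

Lemma spoke_unit s w o y : spoke s w o y -> s y.
Proof. by move=> [_ sP]; apply/sP; exists 1; rewrite scale1r addrC subrK. Qed.

Variable Pi : set (set 'rV[R]_n).
Hypothesis Pi_complex : polyhedral_complex Pi.
Hypothesis Pi_collinear : forall s, Pi s -> collinear s.

Lemma vertex_face s w : Pi s -> Pi [set w] -> s w -> is_face [set w] s.
Proof.
case: Pi_complex => _ _ _ meet Ps Pw sw; have sE : s `&` [set w] = [set w].
  by apply/seteqP; split=> [x []//|x ->].
case: (meet _ _ Ps Pw); rewrite sE; last by case.
by move=> w0; have : [set w] w by []; rewrite w0.
Qed.

(** The functional of which w is the minimal face tells on which side of w the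
    face s lies. *)
Lemma vertex_separated s w : Pi s -> Pi [set w] -> s w ->
  exists f, forall x, s x -> x != w -> pairing f w < pairing f x.
Proof.
move=> Ps Pw sw; have [_ [f fE]] := vertex_face Ps Pw sw.
have [_ wmin] : [set x | s x /\ forall y, s y -> pairing f x <= pairing f y] w.
  by rewrite -fE.
exists f => x sx xw; rewrite lt_neqAle wmin // andbT; apply/eqP => fwx.
move/eqP: xw; apply; have : [set w] x; last by [].
by rewrite fE; split=> // y sy; rewrite -fwx; exact: wmin.
Qed.

(** Along the direction of s, the parameters of the points of s form a closed
    interval that starts at 0, because w is a vertex.  Its supremum, if finite,
    gives the opposite endpoint. *)
Lemma spoke_exists s w : Pi s -> Pi [set w] -> s w ->
  exists o y, [/\ spoke s w o y, Pi [set o] & rational_point y].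
Proof.
move=> Ps Pw sw; case: (Pi_complex) => _ poly face _.
have [ps _] := poly s Ps; have rw : rational_point w := rational_vertex (proj1 (poly _ Pw)).
have [[b0 sb0 b0w]|nb] := pselect (exists2 b, s b & b != w); last first.
  exists w, w; split=> //; split=> [|x]; first by left.
  split=> [sx|[t [_ _ ->]]]; last by rewrite subrr scaler0 addr0.
  exists 0; rewrite scale0r addr0 lexx ler01; split=> //.
  by apply: contra_notP nb => /eqP; exists x.
have [b [sb rb bw]] := polyhedron_rational_other ps sb0 b0w.
have [f fP] := vertex_separated Ps Pw sw.
have fwb := fP b sb bw.
have param x : s x -> exists2 k : R, 0 <= k & x = w + k *: (b - w).
  move=> sx; have [|k xE] := Pi_collinear Ps sw sb sx; first by rewrite eq_sym.
  exists k => //; have [xw|/(fP x sx)] := eqVneq x w; last first.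
    by rewrite xE pairingDr pairingZr pairingBr; nra.
  move: xE; rewrite xw => /eqP; rewrite addrC -subr_eq subrr eq_sym scaler_eq0.
  by rewrite subr_eq0 (negPf bw) orbF => /eqP ->.
have down (t r : R) : s (w + t *: (b - w)) -> 0 <= r <= t -> s (w + r *: (b - w)).
  move=> st /andP[r0 rt]; have [t0|t0] := eqVneq t 0.
    by have -> : r = t; first by apply/eqP; rewrite eq_le rt t0.
  have tpos : 0 < t by rewrite lt_def t0 (le_trans r0).
  have -> : w + r *: (b - w) = w + (r / t) *: (w + t *: (b - w) - w).
    by rewrite [w + t *: _]addrC addrK scalerA divfK.
  by apply: polyhedron_convex; rewrite // divr_ge0 ?(ltW tpos) //= ler_pdivrMr // mul1r.
have [ray|] := pselect (forall N : R, exists2 t, N < t & s (w + t *: (b - w))).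
  exists w, b; split=> //; split=> [|x]; first by right.
  split=> [/param[k k0 ->]|[t [t0 _ ->]]].
    by exists k; split=> // wb; rewrite wb eqxx in bw.
  have [r tr sr] := ray t; apply: down sr _.
  by rewrite t0 ltW.
move=> /existsNP[N Nub].
pose T : set R := [set t | s (w + t *: (b - w))].
have T1 : T 1 by rewrite /T /= scale1r addrC subrK.
have ubT t : T t -> t <= N.
  by move=> Tt; rewrite leNgt; apply/negP => Nt; apply: Nub; exists t.
have supT : has_sup T by split; [exists 1|exists N].
pose m := sup T.
have Tm : T m.
  have clT : closed T.
    apply: (@preimage_closed _ _ (fun t : R => w + t *: (b - w)) s).
      by move=> t _; exact: line_continuous.
    exact: polyhedron_closed.
  by apply: clT; apply: closure_sup; case: supT.
have m1 : 1 <= m by apply: sup_upper_bound.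
have mpos : 0 < m by exact: lt_le_trans m1.
pose y := w + m *: (b - w).
have yw : y - w = m *: (b - w) by rewrite /y addrC addKr.
have wy : w != y.
  rewrite eq_sym -subr_eq0 yw scaler_eq0 negb_or subr_eq0 bw andbT.
  by rewrite gt_eqF.
have Py : Pi [set y].
  apply: (face s) => //; apply: (@endpoint_face _ _ s y w) => //; first exact: Pi_collinear.
  move=> e e0; rewrite -(opprB y w) scalerN opprK yw scalerA.
  rewrite /y -addrA -scalerDl => /(sup_upper_bound supT); rewrite -/m.
  by rewrite gerDl leNgt mulr_gt0.
exists y, y; split=> //; last exact: rational_vertex (proj1 (poly _ Py)).
split=> [|x]; first by left.
split=> [sx|[t [t0 /(_ erefl) t1 ->]]]; last first.
  rewrite yw scalerA; apply: (down m) => //.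
  by rewrite mulr_ge0 ?(ltW mpos) //= ger_pMl.
have [k k0 xE] := param x sx; exists (k / m); split.
- by rewrite divr_ge0 // ltW.
- move=> _; rewrite ler_pdivrMr // mul1r; apply: sup_upper_bound => //.
  by rewrite /T /= -xE.
- by rewrite yw scalerA divfK // gt_eqF.
Qed.

(** At any other point, s continues in both directions, so no functional has
    its only minimum there. *)
Lemma spoke_vertex s w o y v : Pi s -> spoke s w o y -> Pi [set v] -> s v ->
  v = w \/ v = o.
Proof.
move=> Ps spk Pv sv; have sw := spoke_start spk; have sy := spoke_unit spk.
have [f fP] := vertex_separated Ps Pv sv; case: spk => oE sP.
have [[vw|vw] [vo|vo]] := (eqVneq v w, eqVneq v o); [by left|by left|by right|exfalso].
have [t [t0 t1 vE]] := (sP v).1 sv.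
have fw := fP w sw; rewrite eq_sym vw in fw; have {}fw := fw isT.
move: fw; rewrite vE pairingDr pairingZr => fw.
have d0 : pairing f (y - w) < 0 by nra.
have tpos : 0 < t by nra.
case: oE => oE.
  have : pairing f v < pairing f y by apply: fP => //; rewrite -oE eq_sym.
  have -> : pairing f y = pairing f w + pairing f (y - w).
    by rewrite -pairingDr addrC subrK.
  rewrite vE pairingDr pairingZr; have := t1 oE; nra.
have [oy|oy] := eqVneq o y.
  by move: d0; rewrite -oy oE subrr pairing0r ltxx.
have sy' : s (w + (t + 1) *: (y - w)).
  apply/sP; exists (t + 1); split=> //; first by rewrite addr_ge0.
  by move=> oy'; rewrite oy' eqxx in oy.
have [y'v|/(fP _ sy')] := eqVneq (w + (t + 1) *: (y - w)) v.
  move: y'v; rewrite vE scalerDl scale1r addrA => /eqP.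
  rewrite -subr_eq0 [X in X - _]addrC addrK subr_eq0 => /eqP yw.
  by move: d0; rewrite yw subrr pairing0r ltxx.
rewrite vE !pairingDr !pairingZr; nra.
Qed.

(** The functions on the support that are determined by the values g at the
    vertices: affine on segments, constant on half-lines.  On a face without
    vertices the bound to be attained is h itself, hence the value 0. *)
Definition interpolates g phi :=
  (forall s w o y (t : R), Pi s -> Pi [set w] -> Pi [set o] -> spoke s w o y ->
     0 <= t -> (o = y -> t <= 1) -> phi (w + t *: (y - w)) = g w + t * (g o - g w)) /\
  (forall s x, Pi s -> (forall v, s v -> ~ Pi [set v]) -> s x -> phi x = 0).

(** A point that is not a vertex lies in a single face, and the two ways to
    view a segment, from either endpoint, prescribe the same value.  At a vertex
    all prescriptions give the value of g. *)
Lemma interpolation_exists g : exists phi, interpolates g phi.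
Proof.
pose V x r := (exists s w o y, exists t : R, [/\ Pi s, Pi [set w], Pi [set o], spoke s w o y &
    [/\ 0 <= t, o = y -> t <= 1, x = w + t *: (y - w) & r = g w + t * (g o - g w)]]) \/
  (exists s, [/\ Pi s, forall v, s v -> ~ Pi [set v], s x & r = 0]).
have Vvertex x r : Pi [set x] -> V x r -> r = g x.
  move=> Px [|[s [_ nov /nov//]]].
  move=> [s [w [ o [y [t [Ps Pw Po spk [t0 t1 xE ->]]]]]]].
  have sx : s x by apply/spk.2; exists t.
  have [xw|xw] := eqVneq x w.
    have : t *: (y - w) = 0.
      by move/eqP: xE; rewrite xw addrC -subr_eq subrr => /eqP.
    move=> /eqP; rewrite xw scaler_eq0 subr_eq0 => /orP[/eqP ->|/eqP yw].
      by rewrite mul0r addr0.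
    by case: spk.1 => ->; rewrite ?yw subrr mulr0 addr0.
  have [/eqP|xo] := spoke_vertex Ps spk Px sx; first by rewrite (negPf xw).
  have oy : o = y by case: spk.1 => // ow; rewrite xo ow eqxx in xw.
  have yw : y - w != 0 by rewrite subr_eq0 -oy -xo.
  move: xE; rewrite xo {1}oy => /eqP; rewrite addrC -subr_eq => /eqP yE.
  have /eqP : (t - 1) *: (y - w) = 0 by rewrite scalerBl scale1r -yE subrr.
  rewrite scaler_eq0 (negPf yw) orbF subr_eq0 => /eqP ->.
  by rewrite mul1r addrC subrK.
have Vuniq x r r' : V x r -> V x r' -> r = r'.
  have [Px|nPx] := pselect (Pi [set x]).
    by move=> /(Vvertex _ _ Px) -> /(Vvertex _ _ Px) ->.
  have same s s' : Pi s -> Pi s' -> s x -> s' x -> s = s'.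
    by move=> Ps Ps' sx sx'; case: (faces_meet Pi_complex Pi_collinear Ps Ps' sx sx').
  move=> [[s [w [ o [y [t [Ps Pw Po spk [t0 t1 xE ->]]]]]]]|[s [Ps nov sx ->]]];
  move=> [[s' [w' [ o' [y' [t' [Ps' Pw' Po' spk' [t0' t1' xE' ->]]]]]]]|[s' [Ps' nov' sx' ->]]] //.
  - have sx : s x by apply/spk.2; exists t.
    have sx' : s' x by apply/spk'.2; exists t'.
    have E := same _ _ Ps Ps' sx sx'; subst s'.
    have end_mem s0 w0 o0 y0 : spoke s0 w0 o0 y0 -> s0 o0.
      by move=> spk0; case: (spk0) => -[-> _|-> _]; [exact: spoke_unit spk0|exact: spoke_start spk0].
    have ww' := spoke_vertex Ps spk Pw' (spoke_start spk').
    have wo' := spoke_vertex Ps spk Po' (end_mem _ _ _ _ spk').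
    have w'w := spoke_vertex Ps spk' Pw (spoke_start spk).
    have w'o := spoke_vertex Ps spk' Po (end_mem _ _ _ _ spk).
    have [ow|ow] := eqVneq o w.
      have E1 : w' = w by case: ww' => // ->.
      have E2 : o' = w by case: wo' => // ->.
      by rewrite ow E1 E2 subrr !mulr0.
    have ow' : o' != w'.
      apply/eqP => ow'; move/eqP: ow; apply.
      by case: w'w => ->; case: w'o => ->; rewrite ?ow'.
    have oy : o = y by case: spk.1 => // e; rewrite e eqxx in ow.
    have oy' : o' = y' by case: spk'.1 => // e; rewrite e eqxx in ow'.
    subst y y'; have [E1|E1] := ww'.
      have E2 : o' = o by case: wo' => // e; rewrite e E1 eqxx in ow'.
      subst w' o'; congr (_ + _ * _).
      move: xE'; rewrite xE => /addrI /eqP; rewrite -subr_eq0 -scalerBl scaler_eq0.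
      by rewrite !subr_eq0 (negPf ow) orbF => /eqP.
    have E2 : o' = w by case: wo' => // e; rewrite e E1 eqxx in ow'.
    subst w' o'; have : (t - (1 - t')) *: (o - w) = 0.
      have : w + t *: (o - w) - (o + t' *: (w - o)) = 0 by rewrite -xE -xE' subrr.
      by move=> <-; apply/rowP => i; rewrite !mxE; ring.
    move=> /eqP; rewrite scaler_eq0 !subr_eq0 (negPf ow) orbF => /eqP ->; ring.
  - have sx : s x by apply/spk.2; exists t.
    by rewrite -(same _ _ Ps Ps' sx sx') in nov'; case: (nov' w (spoke_start spk)).
  - have sx' : s' x by apply/spk'.2; exists t'.
    by rewrite (same _ _ Ps Ps' sx sx') in nov; case: (nov w' (spoke_start spk')).
exists (fun x => xget 0 (V x)); split=> [s w o y t Ps Pw Po spk t0 t1|s x Ps nov sx].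
  apply: (@Vuniq (w + t *: (y - w))); last by left; exists s, w, o, y, t.
  by apply: xgetPex; exists (g w + t * (g o - g w)); left; exists s, w, o, y, t.
apply: (@Vuniq x); last by right; exists s.
by apply: xgetPex; exists 0; right; exists s.
Qed.

Lemma interpolates_vertex g phi w : interpolates g phi -> Pi [set w] -> phi w = g w.
Proof.
move=> [gphi _] Pw; have [ o [y [spk Po _]]] := spoke_exists Pw Pw erefl.
have := gphi _ _ _ _ 0 Pw Pw Po spk (lexx _) (fun _ => ler01).
by rewrite scale0r addr0 mul0r addr0.
Qed.

(** All coefficients are rational apart from the two values of g. *)
Lemma interpolation_formula g phi s : interpolates g phi -> Pi s ->
  (forall x, s x -> phi x = 0) \/
  exists w o, exists l : 'rV[rat]_n, [/\ Pi [set w], Pi [set o] & forall x, s x ->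
    phi x = g w + (g o - g w) * pairing (of_rat l) (x - w)].
Proof.
move=> [gphi gphi0] Ps; have [[w sw Pw]|nov] := pselect (exists2 w, s w & Pi [set w]); last first.
  by left=> x sx; apply: gphi0 sx => // v sv Pv; apply: nov; exists v.
right; have [ o [y [spk Po [y0 _ y0E]]]] := spoke_exists Ps Pw sw.
case: (Pi_complex) => _ poly _ _.
have [w0 _ w0E] : rational_point w := rational_vertex (proj1 (poly _ Pw)).
exists w, o, ((\sum_i (y0 - w0) 0 i * (y0 - w0) 0 i)^-1 *: (y0 - w0)); split=> // x sx.
have [t [t0 t1 ->]] := (spk.2 x).1 sx; rewrite (gphi _ _ _ _ _ Ps Pw Po spk t0 t1) (addrC w) addrK.
have ywE : y - w = of_rat (y0 - w0).
  by rewrite -y0E -w0E; apply/rowP => i; rewrite !mxE rmorphB.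
have -> : of_rat ((\sum_i (y0 - w0) 0 i * (y0 - w0) 0 i)^-1 *: (y0 - w0)) =
    (pairing (y - w) (y - w))^-1 *: (y - w).
  rewrite ywE pairing_of_rat -fmorphV; apply/rowP => i.
  by rewrite !mxE rmorphM.
rewrite pairingZl pairingZr; congr (_ + _); have [yw|yw] := eqVneq y w.
  by have -> : o = w; [case: spk.1 => ->|rewrite subrr mulr0 mul0r].
rewrite mulrC [_ * (t * _)]mulrCA mulVf ?mulr1 //.
by rewrite gt_eqF // pairing_self_gt0 // subr_eq0.
Qed.

End Spokes.

(** * The envelope as a linear program *)

Section RationalForms.
Context {R : realType} {I : finType}.
Implicit Types (T : (I -> R) -> R).

(** The coefficients are existential, so that the closure properties below
    replace their computation for the inequalities of the linear program. *)
Definition rational_form T := exists (a : I -> rat) (c : rat),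
  forall z, T z = \sum_i ratr (a i) * z i + ratr c.

Lemma rational_form_coord i0 : rational_form (fun z => z i0).
Proof.
exists (fun i => (i == i0)%:R), 0 => z.
rewrite (bigD1 i0) //= big1 => [|i /negPf ->]; last by rewrite rmorph0 mul0r.
by rewrite eqxx rmorph1 rmorph0 mul1r !addr0.
Qed.

Lemma rational_form_const q : rational_form (fun=> ratr q).
Proof.
by exists (fun=> 0), q => z; rewrite big1 ?add0r // => i _; rewrite rmorph0 mul0r.
Qed.

Lemma rational_formD T T' : rational_form T -> rational_form T' ->
  rational_form (fun z => T z + T' z).
Proof.
move=> [a [c Tac]] [a' [c' Tac']]; exists (fun i => a i + a' i), (c + c') => z.
rewrite Tac Tac' addrACA [in RHS]rmorphD -big_split /=; congr (_ + _).
by apply: eq_bigr => i _; rewrite rmorphD mulrDl.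
Qed.

Lemma rational_formZ q T : rational_form T -> rational_form (fun z => ratr q * T z).
Proof.
move=> [a [c Tac]]; exists (fun i => q * a i), (q * c) => z.
rewrite Tac mulrDr mulr_sumr [in RHS]rmorphM; congr (_ + _).
by apply: eq_bigr => i _; rewrite rmorphM mulrA.
Qed.

Lemma rational_form_sum (K : finType) (T : K -> (I -> R) -> R) :
  (forall k, rational_form (T k)) -> rational_form (fun z => \sum_k T k z).
Proof.
move=> QT; elim: (index_enum K) => [|k r IH].
  by exists (fun=> 0), 0 => z; rewrite big_nil big1 ?rmorph0 ?addr0 // => i _; rewrite mul0r.
have [a [c ac]] := rational_formD (QT k) IH.
by exists a, c => z; rewrite big_cons -ac.
Qed.

End RationalForms.

Section Envelope.
Context {R : realType} {n : nat}.
Variables (X : set 'rV[R]_n) (Pi : set (set 'rV[R]_n)) (gamma h : 'rV[R]_n -> R).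
Hypothesis Pi_complex : polyhedral_complex Pi.
Hypothesis Pi_support : complex_support Pi = X.
Hypothesis Pi_collinear : forall s, Pi s -> collinear s.
Hypothesis h_affine : forall s, Pi s -> exists f c, affine_on h s f c.
Hypothesis h_bound : exists C : R, forall y, X y -> h y <= gamma y + C.
Implicit Types (g phi psi : 'rV[R]_n -> R) (s : set 'rV[R]_n) (w o x y v : 'rV[R]_n).

(** The functions over which the envelope of u takes the supremum, for
    h = gamma + u. *)
Definition competitor psi := [/\ PC X psi, forall y, X y -> psi y <= h y &
  exists C : R, forall y, X y -> psi y <= gamma y + C].

Let PiX : polyhedral_structure X Pi. Proof. by []. Qed.

Lemma face_sub_support s x : Pi s -> s x -> X x.
Proof. by move=> Ps sx; rewrite -Pi_support; exists s. Qed.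

Lemma vertex_in_support v : Pi [set v] -> X v.
Proof. by move=> Pv; exact: face_sub_support Pv erefl. Qed.

Lemma vertex_rational v : Pi [set v] -> rational_point v.
Proof. by case: Pi_complex => _ poly _ _ /poly[/rational_vertex]. Qed.

Lemma h_chord s w y (t : R) : Pi s -> s w -> s y -> s (w + t *: (y - w)) ->
  h (w + t *: (y - w)) = h w + t * (h y - h w).
Proof.
move=> Ps sw sy st; have [f [c hfc]] := h_affine Ps.
by rewrite !hfc // !pairingDr pairingZr pairingBr; ring.
Qed.

(** A chord of s is a polyhedral convex combination with common face s. *)
Lemma PC_chord psi s a b (t : R) : PC X psi -> Pi s -> s a -> s b ->
  rational_point a -> rational_point b -> 0 <= t <= 1 ->
  psi (a + t *: (b - a)) <= (1 - t) * psi a + t * psi b.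
Proof.
move=> [_ PCpsi] Ps sa sb ra rb t01; have [ps _] := let: And4 _ poly _ _ := Pi_complex in poly s Ps.
have st := polyhedron_convex ps sa sb t01.
pose xs (i : bool) := if i then b else a; pose al (i : bool) := if i then t else 1 - t.
have := PCpsi (a + t *: (b - a)) bool xs al; rewrite !big_bool /= addrC; apply.
have t0 := t01; move: t0 => /andP[t0 t1]; split.
- by case; split=> //; exact: face_sub_support Ps _.
- by case=> //=; rewrite subr_ge0 t1 lerBlDr lerDl.
- by rewrite big_bool /= addrC subrK.
- split; last exact: face_sub_support Ps _.
  by rewrite big_bool /=; apply/rowP => i; rewrite !mxE; ring.
- exists Pi, s, (fun=> s); split=> // i; split=> //; first by case: i.
  split; first by exists a.
  exists 0; apply/seteqP; split=> x; last by case.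
  by move=> sx; split=> // y _; rewrite pairingC pairing0r pairingC pairing0r.
Qed.

(** After normalisation of the coefficients, a positive relation between
    directions of faces at w is a polyhedral convex combination with
    common face {w}. *)
Lemma vertex_combination psi w (K : finType) (S : K -> set 'rV[R]_n) (Y : K -> 'rV[R]_n)
    (c : K -> R) : PC X psi -> Pi [set w] ->
  (forall k, [/\ Pi (S k), S k w, S k (Y k) & rational_point (Y k)]) ->
  (forall k, 0 <= c k) -> \sum_k c k *: (Y k - w) = 0 ->
  (\sum_k c k) * psi w <= \sum_k c k * psi (Y k).
Proof.
move=> [_ PCpsi] Pw SY c0 cY; pose C := \sum_k c k.
have C0 : 0 <= C by apply: sumr_ge0.
have [Cz|Cnz] := eqVneq C 0.
  have cz k : c k = 0.
    by have /psumr_eq0P := Cz; apply.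
  by rewrite -/C Cz mul0r big1 // => k _; rewrite cz mul0r.
have Cpos : 0 < C by rewrite lt_def Cnz.
have : psi w <= \sum_k (c k / C) * psi (Y k).
  apply: PCpsi; split.
  - by move=> k; have [Ps _ sY rY] := SY k; split=> //; exact: face_sub_support sY.
  - move=> k; rewrite divr_ge0 //= ler_pdivrMr // mul1r /C (bigD1 k) //= lerDl.
    by apply: sumr_ge0.
  - by rewrite -mulr_suml divff.
  - split; last exact: vertex_in_support.
    have YE : \sum_k c k *: (Y k - w) = \sum_k c k *: Y k - C *: w.
      by rewrite /C scaler_suml -sumrB; apply: eq_bigr => k _; rewrite scalerBr.
    apply/esym; transitivity (w + C^-1 *: \sum_k c k *: (Y k - w)).
      rewrite YE scalerBr scalerA mulVf // scale1r addrC subrK scaler_sumr.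
      by apply: eq_bigr => k _; rewrite scalerA mulrC.
    by rewrite cY scaler0 addr0.
  - exists Pi, [set w], S; split=> // k; have [Ps sw sY _] := SY k; split=> //.
    exact: (vertex_face Pi_complex).
rewrite -(ler_pM2l Cpos) mulr_sumr; under [in leRHS]eq_bigr do rewrite mulrA [C * _]mulrC divfK //.
by [].
Qed.

(** On a half-line, psi - h is convex and at most 0: chords to points far away
    show that it does not exceed its value A at the vertex. *)
Lemma competitor_spoke psi s w o y (t : R) : competitor psi ->
  Pi s -> Pi [set w] -> Pi [set o] -> spoke s w o y -> rational_point y ->
  0 <= t -> (o = y -> t <= 1) ->
  psi (w + t *: (y - w)) - h (w + t *: (y - w)) <=
    (psi w - h w) + t * ((psi o - h o) - (psi w - h w)).
Proof.
move=> [PCpsi psih _] Ps Pw Po spk ry t0 t1.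
have sw := spoke_start spk; have sy := spoke_unit spk.
have rw := vertex_rational Pw.
have st : s (w + t *: (y - w)) by apply/spk.2; exists t.
have [oy|oy] := pselect (o = y).
  have t01 : 0 <= t <= 1 by rewrite t0 t1.
  have := PC_chord PCpsi Ps sw sy rw ry t01; rewrite (h_chord Ps) // oy; lra.
have ow : o = w by case: spk.1.
rewrite ow subrr mulr0 addr0; set A := psi w - h w.
apply/ler_addgt0Pr => e e0.
have A0 : A <= 0 by rewrite subr_le0; exact/psih/vertex_in_support.
(* N is so large that the chord to w + N (y - w) exceeds A by at most e *)
pose N := (Num.truncn (t + t * - A / e)).+1.
have N0 : 0 <= t * - A / e by rewrite divr_ge0 ?(ltW e0) // mulr_ge0 // oppr_ge0.
have Nb : t + t * - A / e < N%:R.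
  by apply: Num.Theory.truncnS_gt.
have tN : t <= N%:R by lra.
have Npos : 0 < (N%:R : R) by rewrite ltr0n.
pose z := w + N%:R *: (y - w).
have sz : s z by apply/spk.2; exists N%:R; split=> //; exact: ltW.
have rz : rational_point z.
  move: rw ry => [w0 _ w0E] [y0 _ y0E]; exists (w0 + N%:R *: (y0 - w0)) => //.
  by apply/rowP => i; rewrite /z -w0E -y0E !mxE rmorphD rmorphM rmorphB /= ratr_nat.
have r01 : 0 <= t / N%:R <= 1.
  by rewrite divr_ge0 ?(ltW Npos) //= ler_pdivrMr // mul1r.
have xE : w + t *: (y - w) = w + (t / N%:R) *: (z - w).
  by rewrite /z [w + _ - w]addrC addKr scalerA divfK // gt_eqF.
rewrite xE; have st' : s (w + (t / N%:R) *: (z - w)) by rewrite -xE.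
have chord := PC_chord PCpsi Ps sw sz rw rz r01.
rewrite (h_chord Ps sw sz st').
have hz : 0 <= t / N%:R * (h z - psi z).
  by rewrite mulr_ge0 ?subr_ge0 //; [case/andP: r01|exact/psih/(face_sub_support Ps)].
have tA : t / N%:R * - A <= e.
  rewrite mulrAC ler_pdivrMr // [e * _]mulrC -ler_pdivrMr //; lra.
move: tA hz chord; rewrite /A; lra.
Qed.

Lemma competitor_below psi g phi x : competitor psi ->
  (forall w, Pi [set w] -> psi w - h w <= g w) -> interpolates Pi g phi -> X x ->
  psi x <= phi x + h x.
Proof.
move=> cpsi psig [gphi gphi0]; rewrite -Pi_support => -[s Ps sx].
have [[w sw Pw]|nov] := pselect (exists2 w, s w & Pi [set w]); last first.
  rewrite (gphi0 s) // ?add0r; last by move=> v sv Pv; apply: nov; exists v.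
  by case: cpsi => _ psih _; apply: psih; exact: face_sub_support sx.
have [ o [y [spk Po ry]]] := spoke_exists Pi_complex Pi_collinear Ps Pw sw.
have [t [t0 t1 xE]] := (spk.2 x).1 sx.
have := competitor_spoke cpsi Ps Pw Po spk ry t0 t1; rewrite -xE.
rewrite xE (gphi _ _ _ _ _ Ps Pw Po spk t0 t1) -xE.
have gw := psig w Pw; have go := psig o Po => le_psi.
suff : (psi w - h w) + t * ((psi o - h o) - (psi w - h w)) <= g w + t * (g o - g w) by lra.
case: spk.1 => [/t1|->]; last by rewrite !subrr !mulr0 !addr0.
nra.
Qed.

Lemma interpolation_le0 g phi x : interpolates Pi g phi ->
  (forall w, Pi [set w] -> g w <= 0) -> X x -> phi x <= 0.
Proof.
move=> [gphi gphi0] g0; rewrite -Pi_support => -[s Ps sx].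
have [[w sw Pw]|nov] := pselect (exists2 w, s w & Pi [set w]); last first.
  by rewrite (gphi0 s) // => v sv Pv; apply: nov; exists v.
have [ o [y [spk Po ry]]] := spoke_exists Pi_complex Pi_collinear Ps Pw sw.
have [t [t0 t1 ->]] := (spk.2 x).1 sx; rewrite (gphi _ _ _ _ _ Ps Pw Po spk t0 t1).
have := g0 w Pw; have := g0 o Po.
case: spk.1 => [/t1|->]; last by rewrite subrr mulr0 addr0.
nra.
Qed.

(** The functional l supports the function h + phi at w along all faces, where
    phi interpolates g.  These are finitely many inequalities, linear in l and in
    the values of g, with rational coefficients. *)
Definition slope_supported g w l := forall s, Pi s -> s w -> exists o y,
  [/\ spoke s w o y, Pi [set o], rational_point y &
      pairing l (y - w) <= h y - h w + (g o - g w)].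

Lemma interpolation_affine g phi s : interpolates Pi g phi -> Pi s ->
  exists f c, forall x, s x -> phi x + h x = pairing f x + c.
Proof.
move=> gphi Ps; have [f [c hfc]] := h_affine Ps.
have [phi0|[w [ o [l [_ _ lE]]]]] := interpolation_formula Pi_complex Pi_collinear gphi Ps.
  by exists (of_rat f), (ratr c) => x sx; rewrite phi0 // add0r hfc.
exists ((g o - g w) *: of_rat l + of_rat f),
  (g w - (g o - g w) * pairing (of_rat l) w + ratr c) => x sx.
by rewrite lE // hfc // pairingDl pairingZl pairingBr; ring.
Qed.

(** At a vertex the slope inequalities give a local supporting functional; at
    any other point the affine function of the only face through it is one. *)
Lemma feasible_competitor g phi :
  (forall w, Pi [set w] -> g w <= 0) ->
  (forall w, Pi [set w] -> exists l, slope_supported g w l) ->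
  interpolates Pi g phi -> competitor (fun x => phi x + h x).
Proof.
move=> g0 gl gphi; have [C hC] := h_bound; have aff s := @interpolation_affine g phi s gphi.
have phih y : X y -> phi y + h y <= h y.
  by move=> Xy; rewrite gerDr; exact: interpolation_le0 gphi g0 Xy.
split=> //; last by exists C => y Xy; apply: le_trans (phih y Xy) (hC y Xy).
apply: supported_PC; first by rewrite -Pi_support; exact: affine_faces_continuous.
move=> x Xx; have loc := complex_locally_finite x Pi_complex.
have [Px|nPx] := pselect (Pi [set x]).
  have [l lP] := gl x Px; exists l; apply: filterS loc => z zloc Xz.
  move: (Xz); rewrite -{1}Pi_support => -[s Ps sz].
  have sx := zloc s Ps sz; have [ o [y [spk Po ry ll]]] := lP s Ps sx.
  have [t [t0 t1 zE]] := (spk.2 z).1 sz; have sy := spoke_unit spk.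
  have -> : z - x = t *: (y - x) by rewrite zE addrC addKr.
  rewrite zE (gphi.1 _ _ _ _ _ Ps Px Po spk t0 t1) (h_chord Ps sx sy) -?zE //.
  rewrite (interpolates_vertex Pi_complex Pi_collinear gphi Px) pairingZr; nra.
move: (Xx); rewrite -{1}Pi_support => -[s Ps sx]; have [f [c fc]] := aff s Ps.
exists f; apply: filterS loc => z zloc Xz.
move: (Xz); rewrite -{1}Pi_support => -[s' Ps' s'z].
have [ss|//] := faces_meet Pi_complex Pi_collinear Ps Ps' sx (zloc s' Ps' s'z).
by subst s'; rewrite (fc x sx) (fc z s'z) pairingBr; lra.
Qed.

Hypothesis competitor_nonempty : exists psi, competitor psi.

(** The supremum is that of real numbers; at the vertices the set is nonempty
    and bounded above by 0. *)
Definition vertex_gap v := sup [set psi v - h v | psi in competitor].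

Lemma vertex_gap_ge psi v : competitor psi -> Pi [set v] -> psi v - h v <= vertex_gap v.
Proof.
move=> cpsi Pv; apply: sup_upper_bound; last by exists psi.
split; first by exists (psi v - h v), psi.
exists 0 => _ [chi [_ chih _] <-]; rewrite subr_le0; apply: chih.
exact: vertex_in_support.
Qed.

Lemma vertex_gap_le v M : (forall psi, competitor psi -> psi v - h v <= M) ->
  vertex_gap v <= M.
Proof.
move=> psiM; have [psi cpsi] := competitor_nonempty.
apply: ge_sup; first by exists (psi v - h v), psi.
by move=> _ [chi cchi <-]; exact: psiM.
Qed.

Lemma vertex_gap_le0 v : Pi [set v] -> vertex_gap v <= 0.
Proof.
move=> Pv; apply: vertex_gap_le => psi [_ psih _]; rewrite subr_le0.
exact/psih/vertex_in_support.
Qed.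

(** Each competitor satisfies the inequality of every positive relation between
    the directions at w.  Its values at the far ends of the faces are bounded by
    those of the interpolation, so the supremum over the competitors satisfies
    the inequality too, which is the hypothesis of the Farkas lemma. *)
Lemma vertex_gap_supported w : Pi [set w] -> exists l, slope_supported vertex_gap w l.
Proof.
move=> Pw; case: (Pi_complex) => /finite_seqP[L PiL] _ _ _.
have Pimem s : Pi s = (s \in L) by rewrite PiL.
(* a face that does not contain w is replaced by {w}, whose constraint is void *)
have data (k : 'I_(size L)) : exists D : set 'rV[R]_n * ('rV[R]_n * 'rV[R]_n),
    [/\ Pi D.1, spoke D.1 w D.2.1 D.2.2, Pi [set D.2.1], rational_point D.2.2 &
        nth set0 L k w -> D.1 = nth set0 L k].
  have Pk : Pi (nth set0 L k) by rewrite Pimem mem_nth.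
  have [sw|nsw] := pselect (nth set0 L k w).
    have [ o [y [spk Po ry]]] := spoke_exists Pi_complex Pi_collinear Pk Pw sw.
    by exists (nth set0 L k, (o, y)).
  have [ o [y [spk Po ry]]] := spoke_exists Pi_complex Pi_collinear Pw Pw erefl.
  by exists ([set w], (o, y)).
have [D DP] := choice data.
pose o k := (D k).2.1; pose y k := (D k).2.2.
have [|l lP] := @farkas R n _ (fun k => y k - w)
    (fun k => h (y k) - h w + (vertex_gap (o k) - vertex_gap w)).
  move=> c c0 cd.
  pose C := \sum_k c k; have C0 : 0 <= C by apply: sumr_ge0.
  have [Cz|Cnz] := eqVneq C 0.
    rewrite big1 // => k _.
    by have /psumr_eq0P -> // := Cz; rewrite mul0r.
  have Cpos : 0 < C by rewrite lt_def Cnz.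
  suff : vertex_gap w <= (\sum_k c k * (h (y k) - h w + vertex_gap (o k))) / C.
    rewrite ler_pdivlMr // => gw.
    under eq_bigr do rewrite addrA mulrBr.
    by rewrite sumrB subr_ge0 -mulr_suml mulrC.
  apply: vertex_gap_le => psi cpsi; rewrite ler_pdivlMr //.
  have [PCpsi _ _] := cpsi.
  have comb : C * psi w <= \sum_k c k * psi (y k).
    apply: (vertex_combination (S := fun k => (D k).1) PCpsi Pw _ c0 cd) => k.
    have [PS spk _ ry _] := DP k; split=> //; first exact: spoke_start spk.
    exact: spoke_unit spk.
  have : \sum_k c k * psi (y k) <= \sum_k c k * (h (y k) + vertex_gap (o k)).
    apply: ler_sum => k _; rewrite ler_wpM2l //.
    have [PS spk Po ry _] := DP k.
    have := competitor_spoke cpsi PS Pw Po spk ry ler01 (fun=> lexx _).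
    have -> : w + 1 *: ((D k).2.2 - w) = y k by rewrite scale1r addrC subrK.
    rewrite mul1r.
    have := vertex_gap_ge cpsi Po; rewrite -/(o k); lra.
  have -> : \sum_k c k * (h (y k) - h w + vertex_gap (o k)) =
      \sum_k c k * (h (y k) + vertex_gap (o k)) - C * h w.
    rewrite /C mulr_suml -sumrB; apply: eq_bigr => k _; ring.
  by move: comb; rewrite mulrBl ![_ * C]mulrC; lra.
exists l => s Ps sw; have sL : (index s L < size L)%N by rewrite index_mem -Pimem.
pose k := Ordinal sL; have [PS spk Po ry /= DE] := DP k.
have sE : (D k).1 = s by rewrite DE nth_index // -Pimem.
by exists (o k), (y k); split=> //; rewrite -sE.
Qed.

Lemma finite_vertices : finite_set [set v | Pi [set v]].
Proof.
case: (Pi_complex) => fin _ _ _.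
apply: sub_finite_set (finite_image (xget 0) fin) => v Pv; exists [set v] => //.
by have : exists x, [set v] x by [exists v]; move=> /(xgetPex 0).
Qed.

(** The unknowns of the linear program are the values of g at the vertices and
    the coordinates of the functionals l_w; the gaps are a solution with the
    greatest possible values of g.  Such a solution cannot be moved in both
    directions of a vector that changes the value at v0. *)
Lemma vertex_gap_rational v0 : Pi [set v0] -> is_rational (vertex_gap v0).
Proof.
move=> Pv0; apply: contrapT => irr.
case: (Pi_complex) => /finite_seqP[L PiL] _ _ _.
have Pimem s : Pi s = (s \in L) by rewrite PiL.
have /finite_seqP[V0 V0E] := finite_vertices.
pose V := undup V0; have Vmem v : (v \in V) = Pi [set v] :> Prop.
  by rewrite mem_undup; have := congr1 (@^~ v) V0E; rewrite /= => ->.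
have v0V : (index v0 V < size V)%N by rewrite index_mem Vmem.
pose i0 : 'I_(size V) := Ordinal v0V.
pose vx (i : 'I_(size V)) := nth 0 V i.
pose idx v : 'I_(size V) := insubd i0 (index v V).
have Pvx i : Pi [set vx i] by rewrite -Vmem mem_nth.
have idxK v : Pi [set v] -> vx (idx v) = v.
  by rewrite -Vmem => vV; rewrite /vx val_insubd index_mem vV nth_index.
have vxK i : idx (vx i) = i.
  by apply: val_inj; rewrite val_insubd index_uniq ?undup_uniq // ltn_ord.
have /choice[l lP] : forall w, exists l, Pi [set w] -> slope_supported vertex_gap w l.
  move=> w; have [Pw|nPw] := pselect (Pi [set w]); last by exists 0.
  by have [l lP] := vertex_gap_supported Pw; exists l.
pose spoke_data s w o (D : 'rV[rat]_n) (H : rat) := exists y,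
  [/\ spoke s w o y, rational_point y, y - w = of_rat D & h y - h w = ratr H].
(* the rational data of the slope inequality for a vertex and a face; the
   inequality is void when the face does not contain the vertex *)
have data (p : 'I_(size V) * 'I_(size L)) : exists d : 'I_(size V) * ('rV[rat]_n * rat),
    pairing (l (vx p.1)) (of_rat d.2.1) <=
      ratr d.2.2 + (vertex_gap (vx d.1) - vertex_gap (vx p.1)) /\
    (nth set0 L p.2 (vx p.1) ->
      spoke_data (nth set0 L p.2) (vx p.1) (vx d.1) d.2.1 d.2.2).
  case: p => i j /=; set s := nth set0 L j; set w := vx i.
  have Ps : Pi s by rewrite Pimem mem_nth.
  have [sw|nsw] := pselect (s w); last first.
    exists (i, (0, 0)); split=> //=; rewrite subrr rmorph0 addr0.
    have -> : of_rat 0 = 0 :> 'rV[R]_n by apply/rowP => k; rewrite !mxE rmorph0.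
    by rewrite pairing0r.
  have [ o [y [spk Po ry ll]]] := lP w (Pvx i) s Ps sw.
  have [y0 _ y0E] := ry; have [w0 _ w0E] := vertex_rational (Pvx i).
  have ywE : y - w = of_rat (y0 - w0).
    by rewrite -y0E /w -w0E; apply/rowP => k; rewrite !mxE rmorphB.
  have [f [c hfc]] := h_affine Ps.
  have hE : h y - h w = ratr (\sum_k f 0 k * (y0 - w0) 0 k).
    rewrite -pairing_of_rat -ywE pairingBr !hfc //; last exact: spoke_unit spk.
    by rewrite opprD addrACA subrr addr0.
  exists (idx o, (y0 - w0, \sum_k f 0 k * (y0 - w0) 0 k)); rewrite /= idxK //.
  by split; [rewrite -ywE -hE|move=> _; exists y].
have [d dP] := choice data.
pose I : finType := ('I_(size V) + 'I_(size V) * 'I_n)%type.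
pose J : finType := ('I_(size V) + 'I_(size V) * 'I_(size L))%type.
pose T (j : J) (z : I -> R) : R := match j with
  | inl i => ratr (-1) * z (inl i)
  | inr p => (z (inl (d p).1) + ratr (-1) * z (inl p.1)) +
      (ratr (d p).2.2 + \sum_k ratr (- (d p).2.1 0 k) * z (inr (p.1, k))) end.
have /choice[ac acP] : forall j, exists ac : (I -> rat) * rat,
    forall z, T j z = \sum_i ratr (ac.1 i) * z i + ratr ac.2.
  move=> j; suff [a [c Tac]] : rational_form (T j) by exists (a, c).
  case: j => [i|p]; first exact/rational_formZ/rational_form_coord.
  apply: rational_formD; first apply: rational_formD.
  - exact: rational_form_coord.
  - exact/rational_formZ/rational_form_coord.
  apply: rational_formD; first exact: rational_form_const.
  by apply: rational_form_sum => k; exact/rational_formZ/rational_form_coord.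
pose a j := (ac j).1; pose c j := (ac j).2.
have solE z : solution a c z <-> forall j, 0 <= T j z.
  by split=> sol j; have := sol j; rewrite acP.
have TE p z : T (inr p) z = z (inl (d p).1) - z (inl p.1) + ratr (d p).2.2 -
    pairing (\row_k z (inr (p.1, k))) (of_rat (d p).2.1).
  rewrite /T rmorphN1 mulN1r addrA; congr (_ + _).
  rewrite /pairing -sumrN; apply: eq_bigr => k _.
  by rewrite !mxE rmorphN mulNr mulrC.
(* a solution is realised by a competitor, so its values are at most the gaps *)
have optimal z v : solution a c z -> Pi [set v] -> z (inl (idx v)) <= vertex_gap v.
  move=> /solE Tz Pv; pose g v := z (inl (idx v)).
  have [phi gphi] := interpolation_exists Pi_complex Pi_collinear g.
  have cphi : competitor (fun x => phi x + h x).
    apply: feasible_competitor gphi => // w Pw.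
      by have := Tz (inl (idx w)); rewrite /T /= rmorphN1 mulN1r oppr_ge0.
    exists (\row_k z (inr (idx w, k))) => s Ps sw.
    have sL : (index s L < size L)%N by rewrite index_mem -Pimem.
    pose p := (idx w, Ordinal sL); have [_ /=] := dP p.
    rewrite idxK // nth_index -?Pimem // => /(_ sw)[y [spk ry ywE hE]].
    exists (vx (d p).1), y; split=> //.
    have := Tz (inr p); rewrite TE /= -ywE -hE /g vxK; lra.
  have := vertex_gap_ge cphi Pv; rewrite addrK.
  by rewrite (interpolates_vertex Pi_complex Pi_collinear gphi Pv).
pose z (i : I) : R := match i with
  | inl i => vertex_gap (vx i) | inr p => l (vx p.1) 0 p.2 end.
have solz : solution a c z.
  apply/solE => -[i|p]; first by rewrite /T /= rmorphN1 mulN1r oppr_ge0 vertex_gap_le0.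
  rewrite TE /=; have [+ _] := dP p.
  have -> : \row_k l (vx p.1) 0 k = l (vx p.1) by apply/rowP => k; rewrite mxE.
  lra.
have zirr : ~ is_rational (z (inl (idx v0))) by rewrite /= idxK.
have [q [q0 _ [e e0 eP]]] := solution_perturb solz zirr.
have up : e * ratr (q (inl (idx v0))) <= 0.
  have := optimal _ v0 (eP e _) Pv0; rewrite gtr0_norm //= idxK // => /(_ (lexx _)).
  by rewrite gerDl.
have dn : - e * ratr (q (inl (idx v0))) <= 0.
  have := optimal _ v0 (eP (- e) _) Pv0; rewrite normrN gtr0_norm //= idxK // => /(_ (lexx _)).
  by rewrite gerDl.
move: up dn; rewrite mulNr oppr_le0 => up dn.
have /eqP : e * ratr (q (inl (idx v0))) = 0 by apply/eqP; rewrite eq_le up dn.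
by rewrite mulf_eq0 gt_eqF //= fmorph_eq0 (negPf q0).
Qed.

Lemma greatest_competitor : exists Phi, [/\ competitor Phi, PA_on Pi Phi &
  forall psi x, competitor psi -> X x -> psi x <= Phi x].
Proof.
have [phi gphi] := interpolation_exists Pi_complex Pi_collinear vertex_gap.
exists (fun x => phi x + h x); split.
- apply: feasible_competitor gphi => // w; first exact: vertex_gap_le0.
  exact: vertex_gap_supported.
- split.
    by apply: affine_faces_continuous => // s; exact: (interpolation_affine gphi).
  move=> s Ps; have [f [c hfc]] := h_affine Ps.
  have [phi0|[w [ o [l [Pw Po lE]]]]] := interpolation_formula Pi_complex Pi_collinear gphi Ps.
    by exists f, c => x sx; rewrite phi0 // add0r hfc.
  have [qw wE] := vertex_gap_rational Pw; have [qo oE] := vertex_gap_rational Po.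
  have [w0 _ w0E] := vertex_rational Pw.
  exists ((qo - qw) *: l + f), (qw - (qo - qw) * (\sum_i l 0 i * w0 0 i) + c) => x sx.
  rewrite lE // hfc // wE oE -w0E pairingBr pairing_of_rat.
  have -> : of_rat ((qo - qw) *: l + f) = (ratr qo - ratr qw) *: of_rat l + of_rat f :> 'rV[R]_n.
    by apply/rowP => i; rewrite !mxE rmorphD rmorphM rmorphB.
  rewrite pairingDl pairingZl !(rmorphD, rmorphN, rmorphM) /=.
  ring.
- move=> psi x cpsi Xx; apply: (competitor_below cpsi _ gphi Xx) => w Pw.
  exact: vertex_gap_ge.
Qed.

End Envelope.

Lemma bounded_onP (R : realType) (T : Type) (A : set T) (f : T -> R) :
  [bounded f x : R^o | x in A] <-> exists C : R, forall x, A x -> `|f x| <= C.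
Proof.
split=> [[M [_ MP]]|[C CP]].
  by exists (M + 1) => x Ax; apply: (MP (M + 1)) => //; rewrite ltrDl.
exists C; split; first exact: num_real.
by move=> M CM x Ax /=; apply: le_trans (CP x Ax) (ltW CM).
Qed.

Lemma PC_sub_const (R : realType) (n : nat) (X : set 'rV[R]_n) (phi : 'rV[R]_n -> R) (C : R) :
  PC X phi -> PC X (fun x => phi x - C).
Proof.
move=> [cphi phiP]; split.
  by move=> x; apply: (@cvgB _ R^o); [exact: cphi|exact: cvg_cst].
move=> x I xs al comb; have [_ _ al1 _ _] := comb.
under eq_bigr do rewrite mulrBr.
by rewrite sumrB -mulr_suml al1 mul1r lerD2r; exact: phiP.
Qed.

(** The envelope is the greatest competitor.  It stays at bounded distance from
    gamma because gamma minus a bound of u is a competitor. *)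
Lemma envelope_PAPC (R : realType) (n : nat) (X : set 'rV[R]_n)
    (gamma u : 'rV[R]_n -> R) (Pi : set (set 'rV[R]_n)) :
  one_dim_polyhedral_space X -> PC X gamma ->
  polyhedral_structure X Pi -> PA_on Pi gamma -> PA_on Pi u ->
  [bounded u x : R^o | x in X] ->
  belongs_on X (envelope X gamma u) (PAPC_at X gamma `&` PA_on Pi).
Proof.
move=> hX PCg PiX [_ ag] [_ au] /bounded_onP[C uC].
pose h y := gamma y + u y.
have col s : Pi s -> collinear s by exact: structure_collinear hX PiX.
have h_affine s : Pi s -> exists f c, affine_on h s f c.
  move=> Ps; have [f [c fc]] := ag s Ps; have [f' [c' fc']] := au s Ps.
  exists (f + f'), (c + c') => x sx; rewrite /h fc // fc' // rmorphD /=.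
  have -> : of_rat (f + f') = of_rat f + of_rat f' :> 'rV[R]_n.
    by apply/rowP => i; rewrite !mxE rmorphD.
  by rewrite pairingDl addrACA.
have uC' y : X y -> - C <= u y <= C by move=> /uC; rewrite ler_norml.
have lowest : competitor X gamma h (fun x => gamma x - C).
  split; first exact: PC_sub_const.
    by move=> y /uC' /andP[]; rewrite /h lerD2l.
  by exists (- C).
have [|Phi [cPhi PAPhi Phimax]] := greatest_competitor (gamma := gamma) (proj1 PiX) (proj2 PiX) col h_affine _ (ex_intro _ _ lowest).
  by exists C => y /uC' /andP[_]; rewrite /h lerD2l.
exists Phi.
  split=> //; split; first by split; [exists Pi|case: cPhi].
  apply/bounded_onP; exists C => x Xx; rewrite ler_norml; apply/andP; split.
    by have := Phimax _ x lowest Xx; lra.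
  have [_ Phih _] := cPhi; have := Phih x Xx; rewrite /h; have := uC' x Xx; lra.
move=> x Xx; apply/eqP; rewrite eq_le; apply/andP; split.
  by apply: ge_ereal_sup => _ [psi cpsi <-]; rewrite lee_fin; exact: Phimax.
by apply: ereal_sup_ubound; exists Phi.
Qed.

Theorem proposition6p13 (R : realType) (n : nat) (X : set 'rV[R]_n)
    (gamma : 'rV[R]_n -> R)
    (hX : one_dim_polyhedral_space X) (hbal : balanced X)
    (hgamma : PAPC X gamma) (hpos : positive_at_infinity X gamma) :
  (forall (Pi : set (set 'rV[R]_n)) (u : 'rV[R]_n -> R),
     polyhedral_structure X Pi -> PA_on Pi gamma -> PA_on Pi u ->
     [bounded u x : R^o | x in X] ->
     belongs_on X (envelope X gamma u) (PAPC_at X gamma `&` PA_on Pi)) /\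
  regularity_property X gamma.
Proof.
split=> [Pi u PiX ag au bu|u [Pi2 Pi2X au] bu].
  exact: envelope_PAPC hX hgamma.2 PiX ag au bu.
have [[Pi1 Pi1X ag] PCg] := hgamma.
have [Pi PiX sub] := common_refinement hX Pi1X Pi2X.
have ag' : PA_on Pi gamma.
  by apply: (PA_on_refinement Pi1X PiX _ ag) => s /sub[].
have au' : PA_on Pi u.
  by apply: (PA_on_refinement Pi2X PiX _ au) => s /sub[].
have [Phi [Phiat _] PhiE] := envelope_PAPC hX PCg PiX ag' au' bu.
exists Phi => //; exists (fun=> Phi) => //.
by move=> A nA; exists 0%N => // k _; exact: nbhs_singleton nA.
Qed.
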